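(* Let $p$ be an odd prime, let $k$ be an algebraically closed field of characteristic $p$, and let $1<e_1,e_2,e_3<p$ be integers such that $E:=e_1+e_2+e_3$ is even, $e_3\neq p-1$, and $$p+1\leq E\leq p-1+2\min_{i\in\{1,2,3\}} e_i .$$ Put $d=(E+p-3)/2$ and $\boldsymbol{C}=(d;e_1,e_2,e_3,p-1)$. Put $\tilde d=d+1-e_3=(e_1+e_2-e_3+p-1)/2$, and let $h:\mathbb{P}^1_k\to\mathbb{P}^1_k$ be the unique normalized cover of ramification type $(\tilde d;e_1,e_2,p-e_3)$ with branch locus $(0,1,\infty)$. Write $$h(y)=\frac{y^{e_1}h_1(y)}{h_2(y)},$$ where $h_1,h_2\in k[y]$, the numerator $y^{e_1}h_1$ and the denominator $h_2$ are relatively prime, $\deg(h_1)=\tilde d-e_1$ and $\deg(h_2)=\tilde d-(p-e_3)=(e_1+e_2+e_3-p-1)/2$. Let $\Sigma(\boldsymbol{C})\subset\mathbb{P}^1_k\setminus\{0,1,\infty\}$ be the supersingular locus of $\boldsymbol{C}$. Then $$\Sigma(\boldsymbol{C})=\{y\in\mathbb{P}^1_k\setminus\{0,1,\infty\}\mid h_2(y)=0\}.$$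
   Context: A cover is a finite separable, tamely ramified morphism $f:X\to\mathbb{P}^1_k$ with $X$ a smooth projective connected curve. Branch points are ordered and normalized: $(x_1=0,x_2=1,x_3=\infty)$ or $(x_1=0,x_2=1,x_3=\infty,x_4=\lambda)$ with $\lambda\in\mathbb{P}^1_k\setminus\{0,1,\infty\}$. For integers $e_i>1$, a cover has (single-cycle) ramification type $(d;e_1,\dots,e_r)$ if it has degree $d$, is branched exactly at $x_1,\dots,x_r$, and for each $i$ the fiber over $x_i$ contains exactly one ramified point $y_i$, whose ramification index is $e_i$. Here all types satisfy $\sum_i(e_i-1)=2d-2$, so $X\simeq\mathbb{P}^1_k$. The cover is called normalized if $X=\mathbb{P}^1_k$ and $y_1=0$, $y_2=1$, $y_3=\infty$ (so $0\mapsto 0$, $1\mapsto 1$, $\infty\mapsto\infty$). Every isomorphism class contains a unique normalized representative. Under the hypotheses of the claim there is exactly one normalized cover of type $(\tilde d;e_1,e_2,p-e_3)$. Two covers $f_1:X_1\to\mathbb{P}^1$, $f_2:X_2\to\mathbb{P}^1$ are isomorphic if there is an isomorphism $\iota:X_1\to X_2$ with $f_2\circ\iota=f_1$. The $p$-Hurwitz number $h_p(\boldsymbol{C})$ is the number of isomorphism classes of covers of type $\boldsymbol{C}$ whose branch locus $(0,1,\infty,\lambda)$ is generic; equivalently, the maximum of this number over all $\lambda$. The supersingular locus $\Sigma(\boldsymbol{C})$ is the (finite) set of all $\lambda\in\mathbb{P}^1_k\setminus\{0,1,\infty\}$ for which the number of isomorphism classes of covers of ramification type $\boldsymbol{C}$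 and branch locus $(0,1,\infty,\lambda)$ is strictly less than $h_p(\boldsymbol{C})$. *)

(* Defs.v *)
(* Mathematical Components, with the classical layer of MathComp-Analysis for
   sets and cardinalities *)
From HB Require Import structures.
From mathcomp Require Export all_boot all_order all_algebra all_field.
From mathcomp Require Export finmap.
From mathcomp Require Export boolp classical_sets cardinality.

Set Implicit Arguments.
Unset Strict Implicit.
Unset Printing Implicit Defensive.

Import GRing.Theory.

Local Open Scope classical_set_scope.
Local Open Scope ring_scope.

(* [Some a] is the affine point a, [None] is the point at infinity. *)
Notation P1 k := (option k).

(* k(x), the function field of the projective line.  A nonconstant element is
   the same thing as a finite morphism from the projective line to itself. *)
Notation ratfun k := {fraction {poly k}}.

Section RationalFunctions.
Variable k : closedFieldType.
Implicit Types (f g : ratfun k) (x y : P1 k) (p : {poly k}).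

Definition pt0 : P1 k := Some 0.
Definition pt1 : P1 k := Some 1.
Definition ptoo : P1 k := None.

Definition rpoly p : ratfun k := FracField.tofrac p.
Definition rconst (c : k) : ratfun k := rpoly c%:P.

(* [repr f] is an arbitrary representative of f; numer and denom put it in
   lowest terms (they are only determined up to a common nonzero scalar). *)
Definition numer f : {poly k} :=
  \n_(repr f) %/ gcdp \n_(repr f) \d_(repr f).
Definition denom f : {poly k} :=
  \d_(repr f) %/ gcdp \n_(repr f) \d_(repr f).

Definition degree f : nat := (maxn (size (numer f)) (size (denom f))).-1.

Definition evalr f x : P1 k :=
  match x with
  | Some a =>
      if root (denom f) a then ptoo else Some ((numer f).[a] / (denom f).[a])
  | None =>
      if (size (denom f) < size (numer f))%N then ptoo
      else Some ((numer f)`_(size (denom f)).-1 / lead_coef (denom f))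
  end.

(* Order of vanishing of a nonzero f at x; at infinity it is
   deg (denom f) - deg (numer f). *)
Definition order_at x f : int :=
  match x with
  | Some a => (mup a (numer f))%:Z - (mup a (denom f))%:Z
  | None => (size (denom f))%:Z - (size (numer f))%:Z
  end.

(* The pullback along f of the uniformizer t - c at c, resp. 1/t at infinity. *)
Definition pull_unif f y : ratfun k :=
  match y with
  | Some c => f - rconst c
  | None => f^-1
  end.

(* For nonconstant f the order below is positive, so [absz] loses nothing. *)
Definition ram_index f x : nat := absz (order_at x (pull_unif f (evalr f x))).

Definition ramified f x : Prop := (1 < ram_index f x)%N.

(* Separability of k(x) over k(f): the coordinate x generates k(x) over k(f),
   and its minimal polynomial there is, up to a scalar,
   numer f (T) - f * denom f (T). *)
Definition separable_cover f : Prop :=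
  separable_poly (map_poly rconst (numer f) - f *: map_poly rconst (denom f)).

(* e%:R != 0 in k says that char k does not divide e; the residue field
   extensions are trivial since k is algebraically closed. *)
Definition tame f : Prop := forall x, (ram_index f x)%:R != 0 :> k.

Definition is_cover f : Prop :=
  [/\ (0 < degree f)%N, separable_cover f & tame f].

(* [branch] lists the branch points and [es] the ramification indices above
   them, in the same order.  Only covers with source the projective line
   appear: when \sum_i (e_i - 1) = 2 d - 2 the source has genus 0. *)
Definition has_type (d : nat) (es : seq nat) (branch : seq (P1 k)) f : Prop :=
  [/\ is_cover f,
      degree f = d,
      size es = size branch,
      (forall y, y \in branch <-> exists x, evalr f x = y /\ ramified f x)
    & (forall i, (i < size branch)%N ->
         exists x, [/\ evalr f x = nth ptoo branch i,
                       ram_index f x = nth 0%N es i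
                     & forall x', evalr f x' = nth ptoo branch i ->
                         ramified f x' -> x' = x])].

(* The ramified points above 0, 1, oo are 0, 1, oo respectively. *)
Definition normalized f : Prop :=
  forall x, x \in [:: pt0; pt1; ptoo] -> evalr f x = x /\ ramified f x.

(* Composition f o g, meaningful for nonconstant g. *)
Definition comp_rat f g : ratfun k :=
  (map_poly rconst (numer f)).[g] / (map_poly rconst (denom f)).[g].

(* Both equations force g and g' to be nonconstant. *)
Definition mutually_inverse g g' : Prop :=
  comp_rat g g' = rpoly 'X /\ comp_rat g' g = rpoly 'X.

Definition isomorphic f1 f2 : Prop :=
  exists i i', mutually_inverse i i' /\ comp_rat f2 i = f1.

Definition iso_class f : set (ratfun k) := [set g | isomorphic g f].

Definition iso_classes (d : nat) (es : seq nat) (branch : seq (P1 k)) :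
    set (set (ratfun k)) :=
  iso_class @` [set f | has_type d es branch f].

(* [fset_set] is the empty set on an infinite argument; the sets of classes
   considered here are finite. *)
Definition num_covers (d : nat) (es : seq nat) (branch : seq (P1 k)) : nat :=
  #|` fset_set (iso_classes d es branch)|.

Definition branch3 : seq (P1 k) := [:: pt0; pt1; ptoo].
Definition branch4 (lam : P1 k) : seq (P1 k) := [:: pt0; pt1; ptoo; lam].

Definition P1_minus3 : set (P1 k) := [set y | y \notin branch3].

(* The p-Hurwitz number, as the maximum over all lambda (the supremum in nat of
   a nonempty bounded set is its maximum). *)
Definition hurwitz (d : nat) (es : seq nat) : nat :=
  supremum 0%N [set num_covers d es (branch4 lam) | lam in P1_minus3].

Definition supersingular (d : nat) (es : seq nat) : set (P1 k) :=
  [set lam | P1_minus3 lam /\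
     (num_covers d es (branch4 lam) < hurwitz d es)%N].

End RationalFunctions.

Arguments branch3 k : clear implicits.
Arguments supersingular k d es : clear implicits.

(* Main.v *)
From HB Require Import structures.
Require Import Defs.
From mathcomp Require Import ring zify.

Set Implicit Arguments.
Unset Strict Implicit.
Unset Printing Implicit Defensive.

Import Order.TTheory GRing.Theory Num.Theory.

Local Open Scope classical_set_scope.
Local Open Scope ring_scope.

(** Write h = N / D in lowest terms, with N = y^e1 h1 and D = h2.

    Every cover of type C is isomorphic to a unique one whose ramified points
    above 0, 1 and oo are 0, 1 and oo ([normalize_cover],
    [mutually_inverse_fix3]).  Let f = P / Q be such a normalized cover, with
    fourth branch point l and fourth ramified point m, and put c = m^p.  The
    ramification index p - 1 at m is what ties f to h: the polynomial

      (c - l) P N + (l - 1) c P D - l (c - l) Q N - l (l - 1) x^p Q D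

    vanishes to order e1 at 0, e2 at 1 and p - 1 at m, because x^p - c is
    (x - m)^p, and its degree is smaller than e1 + e2 + p - 1; so it is zero
    ([cover_forms]).  Hence f is the quotient of two explicit combinations of N
    and D ([fourth_cover]), D does not vanish at m, and

      l (c D(m) - N(m)) = c (D(m) - N(m)).

    Conversely each m other than 0 and 1 satisfying these two conditions gives
    a normalized cover above l: the Wronskian of the two combinations is a
    multiple of (x - m)^p times that of N and D, which is a constant times
    x^(e1-1) (x-1)^(e2-1), so all the ramification is known
    ([fourth_cover_has_type]).

    The covers above l therefore correspond to the zeros m, other than 0, 1 and
    the zeros of D, of the polynomial l (x^p D - N) - x^p (D - N)
    ([point_poly]).  For every l its zeros other than 0 and 1 are simple, and
    their number does not depend on l ([points_exist]).  So the number of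
    covers drops exactly when one of these zeros m is a zero of D; as
    N(m) is then nonzero, the equation says m^p = l ([num_covers_generic]).
    Finally, the normalized cover h is unique, again by counting zeros
    ([proportional]), so it is equal to its Frobenius conjugate, and the
    roots of D are permuted by the p-th power map ([frobenius_roots]): l is
    the p-th power of a root of D if and only if D vanishes at l. *)

(** * Rational functions: lowest terms, order, evaluation *)

Section RationalFunctions.
Variable k : closedFieldType.
Implicit Types (f g u : ratfun k) (x y : P1 k) (P Q q : {poly k}) (a b c : k).

HB.instance Definition _ :=
  GRing.RMorphism.copy (@rpoly k) (@FracField.tofrac {poly k}).
HB.instance Definition _ :=
  GRing.RMorphism.copy (@rconst k) (@rpoly k \o @polyC k).

Lemma rpoly_eq0 P : (rpoly P == 0) = (P == 0).
Proof. exact: tofrac_eq0. Qed.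

Lemma rpoly_inj : injective (@rpoly k).
Proof. by move=> P Q /eqP; rewrite /rpoly tofrac_eq => /eqP. Qed.

Lemma rpoly0 : rpoly (0 : {poly k}) = 0.
Proof. exact: (rmorph0 (@rpoly k)). Qed.

Lemma rpoly1 : rpoly (1 : {poly k}) = 1.
Proof. exact: (rmorph1 (@rpoly k)). Qed.

Lemma rpolyD P Q : rpoly (P + Q) = rpoly P + rpoly Q.
Proof. exact: (rmorphD (@rpoly k)). Qed.

Lemma rpolyN P : rpoly (- P) = - rpoly P.
Proof. exact: (rmorphN (@rpoly k)). Qed.

Lemma rpolyB P Q : rpoly (P - Q) = rpoly P - rpoly Q.
Proof. exact: (rmorphB (@rpoly k)). Qed.

Lemma rpolyM P Q : rpoly (P * Q) = rpoly P * rpoly Q.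
Proof. exact: (rmorphM (@rpoly k)). Qed.

Lemma rconst0 : rconst (0 : k) = 0.
Proof. by rewrite /rconst polyC0 rpoly0. Qed.

Lemma rconst1 : rconst (1 : k) = 1.
Proof. by rewrite /rconst polyC1 rpoly1. Qed.

Lemma rpolyZ c P : rpoly (c *: P) = rconst c * rpoly P.
Proof. by rewrite -mul_polyC rpolyM. Qed.

Lemma ratfun_reprE f : f = rpoly \n_(repr f) / rpoly \d_(repr f).
Proof.
have dn0 : rpoly \d_(repr f) != 0 by rewrite rpoly_eq0 denom_ratioP.
apply: (canRL (mulfK dn0)).
rewrite -[in LHS](reprK f) /rpoly; unlock FracField.tofrac.
rewrite -[LHS]FracField.pi_mul; apply/eqmodP => /=; rewrite FracField.equivfE.
rewrite /FracField.mulf !numden_Ratio ?mulr1 ?oner_neq0 ?denom_ratioP //.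
by rewrite reprK mulrC.
Qed.

Lemma gcd_repr_neq0 f : gcdp \n_(repr f) \d_(repr f) != 0.
Proof. by rewrite gcdp_eq0 negb_and denom_ratioP orbT. Qed.

Lemma denom_neq0 f : denom f != 0.
Proof.
by rewrite /denom dvdp_div_eq0 ?dvdp_gcdr // denom_ratioP.
Qed.

Lemma coprime_numer_denom f : coprimep (numer f) (denom f).
Proof. by apply: coprimep_div_gcd; rewrite denom_ratioP orbT. Qed.

Lemma numer_denomE f : f = rpoly (numer f) / rpoly (denom f).
Proof.
rewrite {1}[f]ratfun_reprE.
rewrite -[X in rpoly X / _](divpK (dvdp_gcdl \n_(repr f) \d_(repr f))).
rewrite -[X in _ / rpoly X](divpK (dvdp_gcdr \n_(repr f) \d_(repr f))).
by rewrite !rpolyM -mulf_div divff ?mulr1 // rpoly_eq0 gcd_repr_neq0.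
Qed.

Lemma eq_frac P Q P' Q' : Q != 0 -> Q' != 0 ->
  (rpoly P / rpoly Q == rpoly P' / rpoly Q') = (P * Q' == P' * Q).
Proof.
move=> Q0 Q0'; rewrite eqr_div ?rpoly_eq0 // -!rpolyM.
exact: (inj_eq rpoly_inj).
Qed.

(** Two expressions of f in lowest terms differ by a nonzero scalar. *)
Lemma lowest_terms f P Q : Q != 0 -> coprimep P Q -> f = rpoly P / rpoly Q ->
  exists2 c, c != 0 & numer f = c *: P /\ denom f = c *: Q.
Proof.
move=> Q0 cPQ /eqP; rewrite [X in X == _]numer_denomE eq_frac ?denom_neq0 //.
move=> /eqP e.
have dQ : Q %| denom f.
  rewrite -(Gauss_dvdpr _ (_ : coprimep Q P)); last by rewrite coprimep_sym.
  by rewrite -e dvdp_mull.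
have dd : denom f %| Q.
  rewrite -(Gauss_dvdpr _ (_ : coprimep (denom f) (numer f))).
    by rewrite e dvdp_mull.
  by rewrite coprimep_sym coprime_numer_denom.
have /eqpP[[c1 c2] /= /andP[c10 c20] e'] : denom f %= Q by rewrite /eqp dQ dd.
have ed : denom f = (c2 / c1) *: Q.
  by rewrite mulrC -scalerA -e' scalerA mulVf // scale1r.
exists (c2 / c1); first by rewrite mulf_neq0 // invr_eq0.
split=> //; apply: (mulIf Q0); rewrite e ed; rewrite -scalerAl -scalerAr.
by [].
Qed.

(** For a rational function, being nonconstant is the same as being
    transcendental over k, hence as defining a morphism onto the line. *)
Definition nonconst f := forall c, f != rconst c.

Lemma numer_neq0 f : f != 0 -> numer f != 0.
Proof.
apply: contra => /eqP e; rewrite [f]numer_denomE e.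
by rewrite rpoly0 mul0r.
Qed.

Lemma nonconst_neq0 f : nonconst f -> f != 0.
Proof. by move=> /(_ 0); rewrite rconst0. Qed.

Lemma nonconst_sub f c : nonconst f -> f - rconst c != 0.
Proof. by move=> /(_ c); rewrite subr_eq0. Qed.

(** Comparing degrees in the equality of two products of nonzero polynomials. *)
Lemma predn_add_subz (m n i j : nat) : (0 < m)%N -> (0 < n)%N -> (0 < i)%N ->
  (0 < j)%N -> (i + n).-1 = (m + j).-1 -> j%:Z - i%:Z = n%:Z - m%:Z.
Proof. lia. Qed.

(** The order can be read off any fraction representing f, in lowest terms or
    not. *)
Lemma order_atE x P Q : P != 0 -> Q != 0 ->
  order_at x (rpoly P / rpoly Q) =
  match x with
  | Some a => (mup a P)%:Z - (mup a Q)%:Z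
  | None => (size Q)%:Z - (size P)%:Z
  end.
Proof.
move=> P0 Q0; set f := rpoly P / rpoly Q.
have f0 : f != 0 by rewrite mulf_neq0 ?invr_eq0 ?rpoly_eq0.
have N0 := numer_neq0 f0; have D0 := denom_neq0 f.
have /eqP : f = rpoly P / rpoly Q by [].
rewrite [X in X == _]numer_denomE eq_frac // => /eqP e.
case: x => [a|] /=.
  have := congr1 (mup a) e; rewrite !mupM //; lia.
have := congr1 (fun p : {poly k} => size p) e; rewrite /= !size_mul //.
by apply: predn_add_subz; rewrite size_poly_gt0.
Qed.

Lemma order_atM x f g : f != 0 -> g != 0 ->
  order_at x (f * g) = order_at x f + order_at x g.
Proof.
move=> f0 g0; have Nf := numer_neq0 f0; have Ng := numer_neq0 g0.
have Df := denom_neq0 f; have Dg := denom_neq0 g.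
rewrite {1}[f]numer_denomE {1}[g]numer_denomE mulf_div -!rpolyM.
rewrite order_atE ?mulf_neq0 //; case: x => [a|] /=.
  by rewrite !mupM // !PoszD opprD addrACA.
rewrite !size_mul //; move: Nf Ng Df Dg; rewrite -!size_poly_gt0.
move: (size (numer f)) (size (numer g)) (size (denom f)) (size (denom g)).
clear; lia.
Qed.

Lemma order_at_const x c : c != 0 -> order_at x (rconst c) = 0.
Proof.
move=> c0; rewrite -[rconst c]divr1 -[1]rpoly1.
rewrite order_atE ?polyC_eq0 ?oner_eq0 //.
case: x => [a|]; last by rewrite size_polyC c0 size_poly1.
by rewrite !mupNroot ?root1 // rootC.
Qed.

Lemma order_at1 x : order_at x 1 = 0.
Proof. by rewrite -rconst1 order_at_const ?oner_eq0. Qed.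

Lemma order_atV x f : f != 0 -> order_at x f^-1 = - order_at x f.
Proof.
move=> f0; apply/eqP; rewrite -addr_eq0 -order_atM ?invr_eq0 //.
by rewrite mulVf // order_at1.
Qed.

Lemma order_at_XsubC x a :
  order_at x (rpoly ('X - a%:P)) = if x is Some b then (b == a)%:Z else - 1.
Proof.
rewrite -[rpoly _]divr1 -[1]rpoly1.
rewrite order_atE ?polyXsubC_eq0 ?oner_eq0 //.
case: x => [b|]; last by rewrite size_XsubC size_poly1.
rewrite -['X - _]expr1 mup_XsubCX mupNroot ?root1 //.
by rewrite eq_sym; case: eqP.
Qed.

Lemma evalr_lowest_terms f P Q x : Q != 0 -> coprimep P Q ->
    f = rpoly P / rpoly Q ->
  evalr f x = match x with
  | Some a => if root Q a then None else Some (P.[a] / Q.[a])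
  | None => if (size Q < size P)%N then None
            else Some (P`_(size Q).-1 / lead_coef Q)
  end.
Proof.
move=> Q0 cPQ fE; have [c c0 [nE dE]] := lowest_terms Q0 cPQ fE.
rewrite /evalr nE dE; case: x => [a|].
  by rewrite rootZ // !hornerZ -mulf_div divff // mul1r.
by rewrite !size_scale // lead_coefZ coefZ -mulf_div divff // mul1r.
Qed.

Lemma subr_rconst f c :
  f - rconst c = rpoly (numer f - c *: denom f) / rpoly (denom f).
Proof.
rewrite {1}[f]numer_denomE rpolyB rpolyZ mulrBl mulfK // rpoly_eq0.
exact: denom_neq0.
Qed.

Lemma nonconst_num_neq0 f c : nonconst f -> numer f - c *: denom f != 0.
Proof.
move=> /(nonconst_sub c); rewrite subr_rconst; apply: contra => /eqP ->.
by rewrite rpoly0 mul0r.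
Qed.

(** The order of f - b at x, in terms of the value of f at x. *)
Lemma order_at_subC f x b : nonconst f ->
  match evalr f x with
  | Some c => if c == b then 0%R < order_at x (f - rconst b)
              else order_at x (f - rconst b) == 0
  | None => (order_at x (f - rconst b) == order_at x f)
            && (order_at x f < 0)
  end.
Proof.
move=> ncf; have f0 := nonconst_neq0 ncf.
have N0 := numer_neq0 f0; have D0 := denom_neq0 f.
have NB0 := nonconst_num_neq0 b ncf.
rewrite subr_rconst order_atE //.
rewrite [f in order_at _ f]numer_denomE order_atE //.
have cND := coprime_numer_denom f.
case: x => [a|] /=.
  case: ifP => Dr.
    have Nr : ~~ root (numer f) a.
      by apply/negP => Nr; have := coprimep_root cND Nr; rewrite (eqP Dr) eqxx.
    rewrite (mupNroot (x := a) (q := numer f)) //.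
    rewrite (mupNroot (x := a) (q := _ - _)); last first.
      by rewrite /root !hornerE (eqP Dr) mulr0 subr0.
    rewrite eqxx /= sub0r oppr_lt0.
    by rewrite -[_ < _]/(0 < mup a (denom f))%N -XsubC_dvd // dvdp_XsubCl.
  rewrite (mupNroot (x := a) (q := denom f)) ?Dr // subr0.
  have Da : (denom f).[a] != 0 by rewrite -[_ == _]/(root _ _) Dr.
  have rE : root (numer f - b *: denom f) a =
            ((numer f).[a] / (denom f).[a] == b).
    by rewrite /root !hornerE subr_eq0 -[RHS](inj_eq (mulIf Da)) divfK.
  case: ifP => cb.
    by rewrite -[_ < _]/(0 < mup a _)%N -XsubC_dvd // dvdp_XsubCl rE.
  by rewrite mupNroot // rE cb.
case: ifP => szlt.
  have -> : size (numer f - b *: denom f) = size (numer f).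
    rewrite size_polyDl // size_polyN; apply: leq_ltn_trans szlt.
    exact: size_scale_leq.
  by rewrite eqxx /=; lia.
have szle : (size (numer f) <= size (denom f))%N by rewrite leqNgt szlt.
have szB : (size (numer f - b *: denom f)%R <= size (denom f))%N.
  rewrite (leq_trans (size_polyD _ _)) // geq_max szle size_polyN.
  exact: size_scale_leq.
have l0 : lead_coef (denom f) != 0 by rewrite lead_coef_eq0.
have szD : (0 < size (denom f))%N by rewrite size_poly_gt0.
have coefE : (numer f - b *: denom f)`_(size (denom f)).-1 =
   (numer f)`_(size (denom f)).-1 - b * lead_coef (denom f).
  by rewrite coefB coefZ lead_coefE.
case: ifP => cb.
  suff : (size (numer f - b *: denom f)%R < size (denom f))%N.
    by move=> h; rewrite subr_gt0.
  rewrite ltn_neqAle szB andbT; apply/negP => /eqP e.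
  move: NB0; rewrite -lead_coef_eq0 lead_coefE e coefE -(eqP cb) divfK //.
  by rewrite subrr eqxx.
suff -> : size (numer f - b *: denom f) = size (denom f) by rewrite subrr.
apply/eqP; rewrite eqn_leq szB /= leqNgt; apply/negP => lt.
have : (numer f - b *: denom f)`_(size (denom f)).-1 = 0.
  by apply: nth_default; rewrite -ltnS prednK.
rewrite coefE => /eqP; rewrite subr_eq0 => /eqP e.
by move: cb; rewrite e mulfK // eqxx.
Qed.

Lemma evalr_Some f x c : nonconst f ->
  (evalr f x == Some c) = (0 < order_at x (f - rconst c)).
Proof.
move=> /(order_at_subC x c); case: evalr => [b|].
  rewrite -[Some b == Some c]/(b == c); case: ifP => // _ /eqP ->.
  by rewrite ltxx.
by move=> /andP[/eqP -> lt0]; apply/esym/negbTE; rewrite -leNgt ltW.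
Qed.

Lemma evalr_None f x : nonconst f -> (evalr f x == None) = (order_at x f < 0).
Proof.
move=> ncf; have := order_at_subC x 0 ncf; rewrite rconst0 subr0.
case: evalr => [b|]; last by rewrite !eqxx.
rewrite -[Some b == None]/false => h; apply/esym/negbTE; rewrite -leNgt.
by case: ifP h => _ => [/ltW|/eqP ->].
Qed.

Lemma pull_unif_neq0 f y : nonconst f -> pull_unif f y != 0.
Proof.
case: y => [c|] nc /=; first exact: nonconst_sub.
by rewrite invr_eq0 nonconst_neq0.
Qed.

Lemma ram_indexE f x : nonconst f ->
  (ram_index f x)%:Z = order_at x (pull_unif f (evalr f x)).
Proof.
move=> ncf; rewrite /ram_index; suff: 0 < order_at x (pull_unif f (evalr f x)).
  by move=> /ltW /gez0_abs.
case e: (evalr f x) => [c|] /=; first by rewrite -evalr_Some // e.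
rewrite order_atV ?nonconst_neq0 // oppr_gt0.
by rewrite -evalr_None // e.
Qed.

Lemma ram_index_gt0 f x : nonconst f -> (0 < ram_index f x)%N.
Proof.
move=> ncf; suff: 0 < (ram_index f x)%:Z by [].
rewrite ram_indexE //.
case e: (evalr f x) => [c|] /=; first by rewrite -evalr_Some // e.
rewrite order_atV ?nonconst_neq0 // oppr_gt0.
by rewrite -evalr_None // e.
Qed.

Lemma ram_index_finite f a c : nonconst f -> evalr f (Some a) = Some c ->
  ram_index f (Some a) = mup a (numer f - c *: denom f).
Proof.
move=> ncf e; rewrite /ram_index e /pull_unif subr_rconst.
rewrite order_atE ?denom_neq0 ?nonconst_num_neq0 //.
rewrite (mupNroot (q := denom f)) ?subr0 //.
by move: e; rewrite /evalr; case: ifP.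
Qed.

Lemma ram_index_pole f a : nonconst f -> evalr f (Some a) = None ->
  ram_index f (Some a) = mup a (denom f).
Proof.
move=> ncf e; rewrite /ram_index e /pull_unif order_atV ?nonconst_neq0 //.
rewrite /order_at (mupNroot (q := numer f)) ?sub0r ?opprK //.
move: e; rewrite /evalr; case: ifP => // /eqP Dr _; apply/negP => Nr.
by have := coprimep_root (coprime_numer_denom f) Nr; rewrite Dr eqxx.
Qed.

Lemma ram_index_infty f : nonconst f -> evalr f None = None ->
  ram_index f None = (size (numer f) - size (denom f))%N.
Proof.
move=> ncf e; rewrite /ram_index e /pull_unif order_atV ?nonconst_neq0 //.
rewrite /order_at; move: e; rewrite /evalr; case: ifP => // lt _; lia.
Qed.

End RationalFunctions.

(** * Composition *)

Section Composition.
Variable k : closedFieldType.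
Implicit Types (f g h : ratfun k) (x y : P1 k) (P Q q : {poly k}) (a b c : k).

(** The value q(g) of a polynomial q at a rational function g. *)
Definition subst q g : ratfun k := (map_poly (@rconst k) q).[g].

Lemma substD P Q g : subst (P + Q) g = subst P g + subst Q g.
Proof. by rewrite /subst rmorphD hornerD. Qed.

Lemma substM P Q g : subst (P * Q) g = subst P g * subst Q g.
Proof. by rewrite /subst rmorphM hornerM. Qed.

Lemma substC c g : subst c%:P g = rconst c.
Proof. by rewrite /subst map_polyC hornerC. Qed.

Lemma substZ c q g : subst (c *: q) g = rconst c * subst q g.
Proof. by rewrite -mul_polyC substM substC. Qed.

Lemma substX g : subst 'X g = g.
Proof. by rewrite /subst map_polyX hornerX. Qed.

Lemma rconstN c : rconst (- c) = - rconst c.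
Proof. by rewrite /rconst polyCN rpolyN. Qed.

Lemma subst_XsubC a g : subst ('X - a%:P) g = g - rconst a.
Proof. by rewrite -polyCN substD substX substC rconstN. Qed.

Lemma subst_prod (r : seq k) g :
  subst (\prod_(z <- r) ('X - z%:P)) g = \prod_(z <- r) (g - rconst z).
Proof.
elim: r => [|z r ih]; first by rewrite !big_nil substC rconst1.
by rewrite !big_cons substM ih subst_XsubC.
Qed.

Lemma rconst_eq0 c : (rconst c == 0) = (c == 0).
Proof. by rewrite /rconst rpoly_eq0 polyC_eq0. Qed.

Lemma subst_neq0 q g : nonconst g -> q != 0 -> subst q g != 0.
Proof.
move=> ncg q0; have [r ->] := closed_field_poly_normal q.
rewrite substZ subst_prod mulf_neq0 ?rconst_eq0 ?lead_coef_eq0 //.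
by rewrite prodf_seq_neq0; apply/allP => z _; rewrite nonconst_sub.
Qed.

(** Composition on the right with a nonconstant g is a field endomorphism of
    k(x), which may be computed on any fraction. *)
Lemma comp_ratE g P Q : nonconst g -> Q != 0 ->
  comp_rat (rpoly P / rpoly Q) g = subst P g / subst Q g.
Proof.
move=> ncg Q0; set f := rpoly P / rpoly Q.
have /eqP : f = rpoly P / rpoly Q by [].
rewrite [X in X == _]numer_denomE eq_frac ?denom_neq0 // => /eqP e.
apply/eqP; rewrite /comp_rat -!/(subst _ _).
by rewrite eqr_div ?subst_neq0 ?denom_neq0 // -!substM e.
Qed.

Lemma comp_ratM f g h : nonconst h ->
  comp_rat (f * g) h = comp_rat f h * comp_rat g h.
Proof.
move=> nch; rewrite {1}[f]numer_denomE {1}[g]numer_denomE mulf_div -!rpolyM.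
by rewrite comp_ratE ?mulf_neq0 ?denom_neq0 // !substM -mulf_div.
Qed.

Lemma comp_ratD f g h : nonconst h ->
  comp_rat (f + g) h = comp_rat f h + comp_rat g h.
Proof.
move=> nch; rewrite {1}[f]numer_denomE {1}[g]numer_denomE.
rewrite addf_div ?rpoly_eq0 ?denom_neq0 // -!rpolyM -rpolyD.
rewrite comp_ratE ?mulf_neq0 ?denom_neq0 // substD !substM -addf_div //.
  by rewrite subst_neq0 ?denom_neq0.
by rewrite subst_neq0 ?denom_neq0.
Qed.

Lemma comp_rat_rpoly q h : nonconst h -> comp_rat (rpoly q) h = subst q h.
Proof.
move=> nch; rewrite -[rpoly q]divr1 -[1]rpoly1 comp_ratE ?oner_eq0 //.
by rewrite substC rconst1 divr1.
Qed.

Lemma comp_ratC c h : nonconst h -> comp_rat (rconst c) h = rconst c.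
Proof. by move=> nch; rewrite comp_rat_rpoly // substC. Qed.

Lemma comp_ratV f h : nonconst h -> comp_rat f^-1 h = (comp_rat f h)^-1.
Proof.
move=> nch; have [->|f0] := eqVneq f 0.
  by rewrite invr0 -rconst0 comp_ratC // rconst0 invr0.
rewrite {1}[f]numer_denomE invf_div comp_ratE ?numer_neq0 //.
by rewrite /comp_rat invf_div.
Qed.

Lemma comp_rat_neq0 f h : nonconst h -> f != 0 -> comp_rat f h != 0.
Proof.
move=> nch f0.
by rewrite mulf_neq0 ?invr_eq0 ?subst_neq0 ?numer_neq0 ?denom_neq0.
Qed.

Lemma comp_rat_subC f c h : nonconst h ->
  comp_rat (f - rconst c) h = comp_rat f h - rconst c.
Proof. by move=> nch; rewrite -!rconstN comp_ratD // comp_ratC. Qed.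

Lemma nonconst_comp f g : nonconst f -> nonconst g -> nonconst (comp_rat f g).
Proof.
move=> ncf ncg c; rewrite -subr_eq0 -comp_rat_subC //.
by rewrite comp_rat_neq0 ?nonconst_sub.
Qed.

Lemma subst_comp q g h : nonconst h ->
  subst q (comp_rat g h) = comp_rat (subst q g) h.
Proof.
move=> nch; elim/poly_ind: q => [|q c ih].
  by rewrite !substC comp_ratC.
rewrite !substD !substM !substX !substC comp_ratD // comp_ratM //.
by rewrite comp_ratC // ih.
Qed.

Lemma comp_ratA f g h : nonconst h ->
  comp_rat f (comp_rat g h) = comp_rat (comp_rat f g) h.
Proof.
move=> nch; rewrite [comp_rat f g]/comp_rat comp_ratM // comp_ratV //.
by rewrite -!/(subst _ _) -!subst_comp.
Qed.

Lemma subst_id q : subst q (rpoly 'X) = rpoly q.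
Proof.
elim/poly_ind: q => [|q c ih]; first by rewrite substC rconst0 rpoly0.
by rewrite substD substM ih substX substC rpolyD rpolyM.
Qed.

Lemma comp_rat_id f : comp_rat f (rpoly 'X) = f.
Proof. by rewrite /comp_rat -!/(subst _ _) !subst_id -numer_denomE. Qed.

Lemma nonconst_X : nonconst (rpoly ('X : {poly k})).
Proof.
move=> c; rewrite /rconst (inj_eq (@rpoly_inj k)); apply/negP => /eqP e.
by have := size_polyX k; rewrite e size_polyC; case: (_ == 0).
Qed.

Lemma comp_const c g : comp_rat (rconst c) g = rconst c.
Proof.
have e : rconst c = rpoly c%:P / rpoly 1 by rewrite rpoly1 divr1.
have [c' c0 []] := lowest_terms (oner_neq0 _) (coprimep1 _) e.
move=> nE dE; rewrite /comp_rat nE dE -!/(subst _ _) !substZ !substC rconst1.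
rewrite mulr1.
by rewrite mulrAC divff ?mul1r // rconst_eq0.
Qed.

Lemma mutually_inverse_nonconst g g' :
  mutually_inverse g g' -> nonconst g /\ nonconst g'.
Proof.
suff H (u v : ratfun k) : comp_rat u v = rpoly 'X -> nonconst u.
  by case=> h1 h2; split; [apply: H h1 | apply: H h2].
move=> e c; apply/negP => /eqP uc; move: e; rewrite uc comp_const => e.
by have := nonconst_X c; rewrite -e eqxx.
Qed.

Lemma mutually_inverse_sym g g' : mutually_inverse g g' -> mutually_inverse g' g.
Proof. by case. Qed.

(** Valuations pull back: v_x(f o g) = e_x(g) v_(g(x))(f). *)
Lemma order_comp f g x : nonconst g -> f != 0 ->
  order_at x (comp_rat f g) = order_at (evalr g x) f * (ram_index g x)%:Z.
Proof.
move=> ncg f0.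
have HX a : order_at x (g - rconst a) =
    order_at (evalr g x) (rpoly ('X - a%:P)) * (ram_index g x)%:Z.
  rewrite order_at_XsubC ram_indexE //; have := order_at_subC x a ncg.
  case e: (evalr g x) => [c|] /=; last first.
    move=> /andP[/eqP -> _].
    by rewrite order_atV ?nonconst_neq0 // mulrN mulN1r opprK.
  by have [->|] := eqVneq c a; rewrite ?mul1r // mul0r => _ /eqP.
have Hprod (r : seq k) : order_at x (\prod_(z <- r) (g - rconst z)) =
    order_at (evalr g x) (rpoly (\prod_(z <- r) ('X - z%:P))) *
    (ram_index g x)%:Z.
  elim: r => [|z r ih]; first by rewrite !big_nil rpoly1 !order_at1 mul0r.
  have p0 : \prod_(z <- r) (g - rconst z) != 0.
    by rewrite prodf_seq_neq0; apply/allP => u _; rewrite nonconst_sub.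
  have q0 : rpoly (\prod_(z <- r) ('X - z%:P)) != 0.
    by rewrite rpoly_eq0 monic_neq0 ?monic_prod_XsubC.
  have z0 : rpoly ('X - z%:P) != 0 by rewrite rpoly_eq0 polyXsubC_eq0.
  rewrite !big_cons rpolyM (order_atM _ (nonconst_sub z ncg) p0).
  by rewrite (order_atM _ z0 q0) HX ih mulrDl.
have Hpoly q : q != 0 -> order_at x (subst q g) =
    order_at (evalr g x) (rpoly q) * (ram_index g x)%:Z.
  move=> q0; have [r qE] := closed_field_poly_normal q; rewrite qE.
  have l0 : rconst (lead_coef q) != 0 by rewrite rconst_eq0 lead_coef_eq0.
  have p0 : \prod_(z <- r) ('X - z%:P) != 0 :> {poly k}.
    by rewrite monic_neq0 ?monic_prod_XsubC.
  have p0' : rpoly (\prod_(z <- r) ('X - z%:P)) != 0 by rewrite rpoly_eq0.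
  rewrite substZ rpolyZ (order_atM _ l0 (subst_neq0 ncg p0)).
  rewrite (order_atM _ l0 p0') subst_prod Hprod.
  by rewrite !order_at_const ?lead_coef_eq0 // !add0r.
have N0 := numer_neq0 f0; have D0 := denom_neq0 f.
have sN0 := subst_neq0 ncg N0; have sD0 := subst_neq0 ncg D0.
have rN0 : rpoly (numer f) != 0 by rewrite rpoly_eq0.
have rD0 : rpoly (denom f) != 0 by rewrite rpoly_eq0.
have sV0 := sD0; rewrite -invr_eq0 in sV0.
have rV0 := rD0; rewrite -invr_eq0 in rV0.
rewrite [f in RHS]numer_denomE /comp_rat -!/(subst _ _).
rewrite (order_atM _ sN0 sV0) (order_atM _ rN0 rV0) (order_atV _ sD0).
by rewrite (order_atV _ rD0) !Hpoly // mulrDl mulNr.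
Qed.

Lemma evalr_comp f g x : nonconst f -> nonconst g ->
  evalr (comp_rat f g) x = evalr f (evalr g x).
Proof.
move=> ncf ncg; have ncfg := nonconst_comp ncf ncg.
have r0 : 0 < (ram_index g x)%:Z by exact: ram_index_gt0.
case e: (evalr f (evalr g x)) => [c|]; apply/eqP.
  rewrite evalr_Some // -comp_rat_subC // order_comp ?nonconst_sub //.
  by rewrite pmulr_lgt0 // -evalr_Some // e.
rewrite evalr_None // order_comp ?nonconst_neq0 //.
by rewrite pmulr_llt0 // -evalr_None // e.
Qed.

Lemma ram_index_comp f g x : nonconst f -> nonconst g ->
  ram_index (comp_rat f g) x = (ram_index f (evalr g x) * ram_index g x)%N.
Proof.
move=> ncf ncg; have ncfg := nonconst_comp ncf ncg.
apply/eqP; rewrite -eqz_nat PoszM (ram_indexE _ ncfg) (ram_indexE _ ncf).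
rewrite evalr_comp //.
set y := evalr f _.
have -> : pull_unif (comp_rat f g) y = comp_rat (pull_unif f y) g.
  by case: y => [c|] /=; rewrite ?comp_rat_subC ?comp_ratV.
by rewrite (order_comp _ ncg (pull_unif_neq0 y ncf)).
Qed.

Lemma evalr_id x : evalr (rpoly 'X : ratfun k) x = x.
Proof.
rewrite (@evalr_lowest_terms _ _ 'X 1) ?oner_eq0 ?coprimep1 ?rpoly1 ?divr1 //.
case: x => [a|]; first by rewrite (negPf (root1 _)) hornerX hornerC divr1.
by rewrite size_poly1 size_polyX.
Qed.

Lemma ram_index_id x : ram_index (rpoly 'X : ratfun k) x = 1%N.
Proof.
apply/eqP; rewrite -eqz_nat ram_indexE ?evalr_id; last exact: nonconst_X.
case: x => [a|].
  by rewrite [pull_unif _ _]/= -rpolyB order_at_XsubC eqxx.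
rewrite [pull_unif _ _]/= order_atV ?(nonconst_neq0 nonconst_X) //.
by rewrite -['X]subr0 -polyC0 order_at_XsubC opprK.
Qed.

End Composition.

(** * Isomorphisms of the projective line *)

Section Isomorphisms.
Variable k : closedFieldType.
Implicit Types (f g h i j : ratfun k) (x y : P1 k) (P Q q : {poly k}).
Implicit Types (a b c e s t : k).

Lemma mutually_inverse_comp i i' j j' :
  mutually_inverse i i' -> mutually_inverse j j' ->
  mutually_inverse (comp_rat j i) (comp_rat i' j').
Proof.
move=> mi mj; have [nci nci'] := mutually_inverse_nonconst mi.
have [ncj ncj'] := mutually_inverse_nonconst mj.
case: mi mj => [ii' i'i] [jj' j'j]; split.
  rewrite comp_ratA // -(comp_ratA j) // ii' comp_rat_id //.
by rewrite comp_ratA // -(comp_ratA i') // j'j comp_rat_id.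
Qed.

Lemma isomorphic_refl f : isomorphic f f.
Proof.
exists (rpoly 'X), (rpoly 'X); split; last exact: comp_rat_id.
by split; rewrite comp_rat_id.
Qed.

Lemma isomorphic_sym f g : isomorphic f g -> isomorphic g f.
Proof.
case=> i [i' [mi <-]]; exists i', i; split; first exact: mutually_inverse_sym.
have [_ nci'] := mutually_inverse_nonconst mi.
by rewrite -comp_ratA // (proj1 mi) comp_rat_id.
Qed.

Lemma isomorphic_trans f g h :
  isomorphic f g -> isomorphic g h -> isomorphic f h.
Proof.
case=> i [i' [mi <-]] [j [j' [mj <-]]].
exists (comp_rat j i), (comp_rat i' j'); split.
  exact: mutually_inverse_comp.
by rewrite comp_ratA //; case: (mutually_inverse_nonconst mi).
Qed.

Lemma iso_class_eq f g : isomorphic f g -> iso_class f = iso_class g.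
Proof.
move=> fg; apply/seteqP; split=> h /= hh.
  exact: isomorphic_trans hh fg.
exact: isomorphic_trans hh (isomorphic_sym fg).
Qed.

Lemma iso_class_inj f g : iso_class f = iso_class g -> isomorphic f g.
Proof.
move=> /seteqP[+ _] => /(_ f); apply; exact: isomorphic_refl.
Qed.

Lemma mutually_inverse_evalK i i' x :
  mutually_inverse i i' -> evalr i (evalr i' x) = x.
Proof.
move=> mi; have [nci nci'] := mutually_inverse_nonconst mi.
by rewrite -evalr_comp // (proj1 mi) evalr_id.
Qed.

Lemma mutually_inverse_ram_index i i' x :
  mutually_inverse i i' -> ram_index i x = 1%N.
Proof.
move=> mi; have [nci nci'] := mutually_inverse_nonconst mi.
have := ram_index_id x; rewrite -(proj2 mi) ram_index_comp // => /eqP.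
by rewrite muln_eq1 => /andP[_ /eqP].
Qed.

Lemma mutually_inverse_evalr_inj i i' :
  mutually_inverse i i' -> injective (evalr i).
Proof.
move=> mi; apply: (can_inj (g := evalr i')) => x.
exact: mutually_inverse_evalK (mutually_inverse_sym mi).
Qed.

(** An automorphism of the line fixing 0, 1 and oo is the identity. *)
Lemma mutually_inverse_fix3 i i' : mutually_inverse i i' ->
  evalr i (pt0 k) = pt0 k -> evalr i (pt1 k) = pt1 k ->
  evalr i (ptoo k) = ptoo k -> i = rpoly 'X.
Proof.
move=> mi i0 i1 ioo; have [nci _] := mutually_inverse_nonconst mi.
have inj := mutually_inverse_evalr_inj mi.
have D0 := denom_neq0 i.
have sD : size (denom i) = 1%N.
  apply/eqP; rewrite -[_ == _]negbK; apply/negP => /closed_rootP[a ra].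
  have : evalr i (Some a) = evalr i (ptoo k) by rewrite ioo /evalr ra.
  by move/inj.
have [c c0 DE] : exists2 c, c != 0 & denom i = c%:P.
  by apply/size_poly1P/eqP.
pose P := c^-1 *: numer i.
have iP : i = rpoly P.
  have := numer_denomE i; rewrite DE => e; rewrite [LHS]e /P rpolyZ mulrC.
  congr (_ * _); apply: (mulfI (x := rpoly c%:P)).
    by rewrite rpoly_eq0 polyC_eq0.
  by rewrite mulfV ?rpoly_eq0 ?polyC_eq0 // -rpolyM -polyCM divff //.
have iE1 : i = rpoly P / rpoly 1 by rewrite rpoly1 divr1.
have evE a : evalr i (Some a) = Some P.[a].
  rewrite (evalr_lowest_terms _ (oner_neq0 _) (coprimep1 _) iE1).
  by rewrite (negPf (root1 _)) hornerC divr1.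
have P1 : P.[1] = 1 by move: i1; rewrite /pt1 evE => -[].
have root0 a : root P a -> a = 0.
  move=> /eqP Pa; suff : Some a = pt0 k by case.
  by apply: inj; rewrite i0 evE Pa.
have P0 : P != 0.
  apply/eqP => e; move: P1; rewrite e horner0 => /eqP.
  by rewrite eq_sym oner_eq0.
have [n PE] : exists n, P = 'X^n.
  have [r rE] := closed_field_poly_normal P.
  have l0 : lead_coef P != 0 by rewrite lead_coef_eq0.
  have r0 z : z \in r -> z = 0.
    by move=> zr; apply: root0; rewrite rE rootZ // root_prod_XsubC.
  have pE : \prod_(z <- r) ('X - z%:P) = 'X^(size r) :> {poly k}.
    rewrite (eq_big_seq (fun _ => 'X)); last first.
      by move=> z /r0 ->; rewrite subr0.
    by rewrite big_const_seq count_predT iter_mulr_1.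
  exists (size r); move: P1; rewrite rE pE hornerZ hornerXn expr1n mulr1 => ->.
  by rewrite scale1r.
have := mutually_inverse_ram_index (pt0 k) mi => /eqP.
rewrite -eqz_nat ram_indexE // i0 /pt0 /pull_unif rconst0 subr0 iE1 PE.
rewrite order_atE ?oner_eq0 -?PE // PE -['X]subr0 -polyC0 mup_XsubCX eqxx.
rewrite mupNroot ?root1 // subr0 eqz_nat => /eqP ->.
by rewrite expr1 polyC0 subr0 rpoly1 divr1.
Qed.

End Isomorphisms.

(** * Moebius transformations and normalization *)

Section Moebius.
Variable k : closedFieldType.
Implicit Types (f g h i j : ratfun k) (x y : P1 k) (A B P Q q : {poly k}).
Implicit Types (a b c e s t : k).

Lemma frac_lowest_dvd f P Q : Q != 0 -> f = rpoly P / rpoly Q ->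
  numer f %| P /\ denom f %| Q.
Proof.
move=> Q0 /eqP; rewrite [X in X == _]numer_denomE eq_frac ?denom_neq0 //.
move=> /eqP e; have cnd := coprime_numer_denom f; split.
  by rewrite -(Gauss_dvdpl _ cnd) -e dvdp_mulr.
rewrite coprimep_sym in cnd.
by rewrite -(Gauss_dvdpr _ cnd) e dvdp_mull.
Qed.

Lemma degree_frac_le f P Q n : Q != 0 -> f = rpoly P / rpoly Q ->
  (size P <= n.+1)%N -> (size Q <= n.+1)%N -> (degree f <= n)%N.
Proof.
move=> Q0 fE sP sQ; have [nP dQ] := frac_lowest_dvd Q0 fE.
suff : (maxn (size (numer f)) (size (denom f)) <= n.+1)%N.
  by rewrite /degree; case: (maxn _ _).
rewrite geq_max.
rewrite (leq_trans (dvdp_leq Q0 dQ)) // andbT.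
have [P0|P0] := eqVneq P 0; last exact: leq_trans (dvdp_leq P0 nP) sP.
have -> : numer f = 0; last by rewrite size_poly0.
apply/eqP; have [//|n0] := boolP (numer f == 0).
have : f != 0.
  by rewrite [f]numer_denomE mulf_neq0 ?invr_eq0 ?rpoly_eq0 ?denom_neq0.
by rewrite fE P0 rpoly0 mul0r eqxx.
Qed.

Lemma nonconst_degree f : (0 < degree f)%N -> nonconst f.
Proof.
move=> d0 c; apply/negP => /eqP fE; move: d0; rewrite ltnNge => /negP; apply.
apply: (@degree_frac_le _ c%:P 1); rewrite ?oner_eq0 ?size_poly1 ?size_polyC //.
  by rewrite rpoly1 divr1.
by case: (_ == 0).
Qed.

(** Substituting a fraction of linear polynomials does not raise the degree. *)
Lemma degree_comp_le f A B : B != 0 -> (size A <= 2)%N -> (size B <= 2)%N ->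
  nonconst (rpoly A / rpoly B) ->
  (degree (comp_rat f (rpoly A / rpoly B)) <= degree f)%N.
Proof.
move=> B0 sA sB nc; set g := rpoly A / rpoly B; set n := degree f.
pose hom q : {poly k} := \sum_(i < n.+1) q`_i *: (A ^+ i * B ^+ (n - i)).
have rB0 : rpoly B != 0 by rewrite rpoly_eq0.
have homE q : (size q <= n.+1)%N -> rpoly (hom q) = subst q g * rpoly (B ^+ n).
  move=> sq; rewrite /subst (@horner_coef_wide _ n.+1); last first.
    by rewrite (leq_trans (size_poly _ _)).
  rewrite mulr_suml /hom.
  rewrite (big_morph _ (@rpolyD k) (rpoly0 k)); apply: eq_bigr => i _.
  rewrite coef_map rpolyZ -mulrA; congr (_ * _).
  have -> : B ^+ n = B ^+ i * B ^+ (n - i).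
    by rewrite -exprD subnKC // -ltnS.
  rewrite !rpolyM mulrA; congr (_ * _).
  rewrite /rpoly !rmorphXn -!/(rpoly _) -exprMn /g divfK //.
have shom q : (size (hom q) <= n.+1)%N.
  apply: (leq_trans (size_sum _ _ _)); apply/bigmax_leqP => i _.
  apply: (leq_trans (size_scale_leq _ _)).
  apply: (leq_trans (size_polyMleq _ _)).
  have := size_poly_exp_leq A i; have := size_poly_exp_leq B (n - i).
  have := ltn_ord i.
  have : ((size A).-1 * i <= i)%N.
    by move: sA; case: (size A) => [|[|[|]]] //= _; rewrite ?mul0n ?mul1n.
  have : ((size B).-1 * (n - i) <= n - i)%N.
    by move: sB; case: (size B) => [|[|[|]]] //= _; rewrite ?mul0n ?mul1n.
  move: (nat_of_ord i) (size (A ^+ i)) (size (B ^+ (n - i)))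
    ((size A).-1 * i)%N ((size B).-1 * (n - i))%N.
  clear; move: n => n; lia.
have sN : (size (numer f) <= n.+1)%N.
  by rewrite /n /degree (leq_trans _ (leqSpred _)) // leq_maxl.
have sD : (size (denom f) <= n.+1)%N.
  by rewrite /n /degree (leq_trans _ (leqSpred _)) // leq_maxr.
have Bn0 : rpoly (B ^+ n) != 0 by rewrite rpoly_eq0 expf_neq0.
apply: (@degree_frac_le _ (hom (numer f)) (hom (denom f))) => //.
  have : subst (denom f) g * rpoly (B ^+ n) != 0.
    exact: mulf_neq0 (subst_neq0 nc (denom_neq0 f)) Bn0.
  by rewrite -homE // rpoly_eq0.
rewrite (homE _ sN) (homE _ sD) -mulf_div (divff Bn0) mulr1.
by [].
Qed.

(** The polynomial a x + b; a and b may both vanish. *)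
Definition lin a b : {poly k} := a *: 'X + b%:P.

(** The function (a x + b) / (c x + e); it has degree 1 when a e - b c is
    nonzero. *)
Definition moebius a b c e : ratfun k := rpoly (lin a b) / rpoly (lin c e).

Lemma size_lin a b : (size (lin a b) <= 2)%N.
Proof.
rewrite (leq_trans (size_polyD _ _)) // geq_max size_polyC.
rewrite (leq_trans (size_scale_leq _ _)) ?size_polyX //.
by case: (b == 0).
Qed.

Lemma size_lin2 a b : a != 0 -> size (lin a b) = 2%N.
Proof.
move=> a0; rewrite /lin size_polyDl size_scale // size_polyX // size_polyC.
by case: (_ == _).
Qed.

Lemma coef_lin a b n : (lin a b)`_n =
  if n is n'.+1 then (if n' is _.+1 then 0 else a) else b.
Proof.
rewrite coefD coefZ coefX coefC; case: n => [|[|n]] /=.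
- by rewrite mulr0 add0r.
- by rewrite mulr1 addr0.
- by rewrite mulr0 addr0.
Qed.

Lemma lin_neq0 a b : (a != 0) || (b != 0) -> lin a b != 0.
Proof.
apply: contraL => /eqP e; rewrite negb_or !negbK.
have := coef_lin a b 1; have := coef_lin a b 0; rewrite e !coef0 /= => <- <-.
by rewrite eqxx.
Qed.

Lemma horner_lin a b c : (lin a b).[c] = a * c + b.
Proof. by rewrite /lin !hornerE. Qed.

Section Det.
Variables (a b c e : k).
Hypothesis det0 : a * e - b * c != 0.

Lemma moebius_denom_neq0 : lin c e != 0.
Proof.
apply: lin_neq0; rewrite -negb_and; apply: contra det0 => /andP[/eqP -> /eqP ->].
by rewrite !mulr0 subrr.
Qed.

Lemma coprime_lin : coprimep (lin a b) (lin c e).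
Proof.
apply/Bezout_coprimepP; exists ((- c)%:P, a%:P).
have -> : (- c)%:P * lin a b + a%:P * lin c e = (a * e - b * c)%:P.
  rewrite /lin -!mul_polyC polyCN polyCB !polyCM; ring.
by rewrite polyC_eqp1.
Qed.

Lemma nonconst_moebius : nonconst (moebius a b c e).
Proof.
move=> t; apply/negP => /eqP mE; move: det0.
have: rpoly (lin a b) = rpoly (t *: lin c e).
  by rewrite rpolyZ -mE /moebius divfK // rpoly_eq0 moebius_denom_neq0.
move/rpoly_inj => h; have := congr1 (fun q : {poly k} => q`_0) h.
have := congr1 (fun q : {poly k} => q`_1) h.
rewrite /= !coefZ !coef_lin => -> ->.
by rewrite mulrAC subrr eqxx.
Qed.

End Det.

(** Homogeneous coordinates of a point: (a : 1), or (1 : 0) at infinity. *)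
Definition hom x : k * k := if x is Some a then (a, 1) else (1, 0).

Lemma hom_det x y : x <> y ->
  (hom x).1 * (hom y).2 - (hom x).2 * (hom y).1 != 0.
Proof.
case: x => [a|]; case: y => [b|] //= xy.
- rewrite mulr1 mul1r subr_eq0; apply/negP => /eqP ab; apply: xy.
  by rewrite ab.
- by rewrite mulr0 mul1r sub0r oppr_eq0 oner_eq0.
- by rewrite mul0r mul1r subr0 oner_eq0.
Qed.

(** The point with homogeneous coordinates (s : t); meaningful when s and t are
    not both zero. *)
Definition P1_of s t : P1 k := if t == 0 then None else Some (s / t).

Lemma P1_of_hom x r : r != 0 -> P1_of (r * (hom x).1) (r * (hom x).2) = x.
Proof.
case: x => [a|] r0; rewrite /P1_of /= ?mulr1 ?mulr0 ?eqxx // (negPf r0).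
by rewrite mulrC mulKf.
Qed.

Lemma evalr_moebius a b c e x : a * e - b * c != 0 ->
  evalr (moebius a b c e) x =
  P1_of (a * (hom x).1 + b * (hom x).2) (c * (hom x).1 + e * (hom x).2).
Proof.
move=> det0; have D0 := moebius_denom_neq0 det0.
rewrite (evalr_lowest_terms x D0 (coprime_lin det0) erefl) /P1_of.
case: x => [u|] /=; first by rewrite /root !horner_lin !mulr1.
rewrite !mulr1 !mulr0 !addr0; have [c0|c0] := eqVneq c 0.
  have a0 : a != 0.
    by move: det0; rewrite c0 mulr0 subr0 mulf_eq0 negb_or => /andP[].
  have -> : size (lin a b) = 2%N by exact: size_lin2.
  by rewrite /lin c0 scale0r add0r size_polyC; case: (_ == _).
have -> : size (lin c e) = 2%N by exact: size_lin2.
rewrite ltnNge size_lin /= coef_lin lead_coefE.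
have -> : size (lin c e) = 2%N by exact: size_lin2.
by rewrite coef_lin.
Qed.

Lemma comp_moebius_inverse a b c e : a * e - b * c != 0 ->
  comp_rat (moebius a b c e) (moebius e (- b) (- c) a) = rpoly 'X.
Proof.
move=> det0; have det0' : e * a - (- b) * (- c) != 0.
  by rewrite mulrNN mulrC.
have nc := nonconst_moebius det0'; have D0 := moebius_denom_neq0 det0.
have D0' := moebius_denom_neq0 det0'.
have rD0' : rpoly (lin (- c) a) != 0 by rewrite rpoly_eq0.
rewrite [moebius a b c e]/moebius comp_ratE //.
have sE u v : subst (lin u v) (moebius e (- b) (- c) a) =
    rpoly (u *: lin e (- b) + v *: lin (- c) a) / rpoly (lin (- c) a).
  rewrite /lin substD substZ substX substC -!/(lin _ _) rpolyD !rpolyZ.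
  by rewrite mulrDl mulfK // -mulrA.
rewrite !sE.
have -> : a *: lin e (- b) + b *: lin (- c) a = (a * e - b * c) *: 'X.
  rewrite /lin -!mul_polyC !polyCN polyCB !polyCM; ring.
have -> : c *: lin e (- b) + e *: lin (- c) a = (a * e - b * c)%:P.
  rewrite /lin -!mul_polyC !polyCN polyCB !polyCM; ring.
have rd0 : rconst (a * e - b * c) != 0 by rewrite rconst_eq0.
have div_div (u v w : ratfun k) : v != 0 -> u / v / (w / v) = u / w.
  by move=> v0; rewrite invf_div mulrA divfK.
by rewrite (div_div _ _ _ rD0') rpolyZ mulrAC (divff rd0) mul1r.
Qed.

Lemma mutually_inverse_moebius a b c e : a * e - b * c != 0 ->
  mutually_inverse (moebius a b c e) (moebius e (- b) (- c) a).
Proof.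
move=> det0; split; first exact: comp_moebius_inverse.
have := @comp_moebius_inverse e (- b) (- c) a.
by rewrite !opprK mulrNN mulrC; apply.
Qed.

(** The automorphisms of the line are transitive on triples of distinct
    points. *)
Lemma moebius_exists x1 x2 x3 : x1 <> x2 -> x1 <> x3 -> x2 <> x3 ->
  exists a b c e, [/\ a * e - b * c != 0,
    evalr (moebius a b c e) (pt0 k) = x1,
    evalr (moebius a b c e) (pt1 k) = x2 &
    evalr (moebius a b c e) (ptoo k) = x3].
Proof.
move=> /hom_det d12 /hom_det d13 /hom_det d23.
set s1 := (hom x1).1 in d12 d13 *; set t1 := (hom x1).2 in d12 d13 *.
set s2 := (hom x2).1 in d12 d23 *; set t2 := (hom x2).2 in d12 d23 *.
set s3 := (hom x3).1 in d13 d23 *; set t3 := (hom x3).2 in d13 d23 *.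
(* Cramer's rule: u v3 + v v1 is proportional to v2, where v1, v2, v3 are
   homogeneous coordinates of x1, x2, x3. *)
pose u := - (s1 * t2 - t1 * s2); pose v := - (s2 * t3 - t2 * s3).
have u0 : u != 0 by rewrite oppr_eq0.
have v0 : v != 0 by rewrite oppr_eq0.
have det0 : u * s3 * (v * t1) - v * s1 * (u * t3) != 0.
  have -> : u * s3 * (v * t1) - v * s1 * (u * t3) =
    - (u * v * (s1 * t3 - t1 * s3)) by ring.
  by rewrite oppr_eq0 !mulf_neq0.
exists (u * s3), (v * s1), (u * t3), (v * t1); split=> //.
- rewrite evalr_moebius //= !mulr0 !mulr1 !add0r; exact: P1_of_hom.
- rewrite evalr_moebius //= !mulr1.
  have -> : u * s3 + v * s1 = - (s1 * t3 - t1 * s3) * s2 by rewrite /u /v; ring.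
  have -> : u * t3 + v * t1 = - (s1 * t3 - t1 * s3) * t2 by rewrite /u /v; ring.
  by apply: P1_of_hom; rewrite oppr_eq0.
- rewrite evalr_moebius //= !mulr0 !mulr1 !addr0; exact: P1_of_hom.
Qed.

(** Every cover with branch points 0, 1, oo, l is isomorphic to one whose
    ramified points above 0, 1 and oo are 0, 1 and oo.  Only the consequences
    needed to identify the latter are recorded. *)
Lemma normalize_cover d n1 n2 n3 n4 l f : l != 0 -> l != 1 ->
  has_type d [:: n1; n2; n3; n4] (branch4 (Some l)) f ->
  exists g m, isomorphic f g /\ nonconst g /\ (degree g <= d)%N /\
   [/\ evalr g (pt0 k) = pt0 k, evalr g (pt1 k) = pt1 k,
       evalr g (ptoo k) = ptoo k & evalr g (Some m) = Some l] /\
   [/\ ram_index g (pt0 k) = n1, ram_index g (pt1 k) = n2,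
       ram_index g (ptoo k) = n3 & ram_index g (Some m) = n4].
Proof.
move=> l0 l1 [[dgt0 _ _] dE _ _ fib]; have ncf := nonconst_degree dgt0.
have [x1 [/= f1 r1 _]] := fib 0%N isT.
have [x2 [/= f2 r2 _]] := fib 1%N isT.
have [x3 [/= f3 r3 _]] := fib 2%N isT.
have [x4 [/= f4 r4 _]] := fib 3%N isT.
have x12 : x1 <> x2.
  by move=> e; move: f1; rewrite e f2 => -[/eqP]; rewrite oner_eq0.
have x13 : x1 <> x3 by move=> e; move: f1; rewrite e f3.
have x23 : x2 <> x3 by move=> e; move: f2; rewrite e f3.
have [a [b [c [e [det0 i1 i2 i3]]]]] := moebius_exists x12 x13 x23.
have mi := mutually_inverse_moebius det0.
set i := moebius a b c e in mi i1 i2 i3; set i' := moebius e _ _ _ in mi.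
have nci : nonconst i := nonconst_moebius det0.
have i4 := mutually_inverse_evalK x4 mi.
have ram x : ram_index (comp_rat f i) x = ram_index f (evalr i x).
  by rewrite ram_index_comp // (mutually_inverse_ram_index _ mi) muln1.
have [m mE] : exists m, evalr i' x4 = Some m.
  case e4: (evalr i' x4) => [m|]; first by exists m.
  by move: i4; rewrite e4 i3 => e34; move: f3; rewrite e34 f4.
exists (comp_rat f i), m; split.
  by apply: isomorphic_sym; exists i, i'.
split; first exact: nonconst_comp.
split.
  rewrite -dE; apply: degree_comp_le nci; [|exact: size_lin|exact: size_lin].
  exact: moebius_denom_neq0 det0.
have ev x : evalr (comp_rat f i) x = evalr f (evalr i x) by rewrite evalr_comp.
have i4' : evalr i (Some m) = x4 by rewrite -mE.
have g1 : evalr (comp_rat f i) (pt0 k) = pt0 k by rewrite ev i1.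
have g2 : evalr (comp_rat f i) (pt1 k) = pt1 k by rewrite ev i2.
have g3 : evalr (comp_rat f i) (ptoo k) = ptoo k by rewrite ev i3.
have g4 : evalr (comp_rat f i) (Some m) = Some l by rewrite ev i4'.
have h1 : ram_index (comp_rat f i) (pt0 k) = n1 by rewrite ram i1.
have h2 : ram_index (comp_rat f i) (pt1 k) = n2 by rewrite ram i2.
have h3 : ram_index (comp_rat f i) (ptoo k) = n3 by rewrite ram i3.
have h4 : ram_index (comp_rat f i) (Some m) = n4 by rewrite ram i4'.
by do 2!split.
Qed.

End Moebius.

(** * Ramification and the Wronskian *)

Section Wronskian.
Variable k : closedFieldType.
Implicit Types (f g : ratfun k) (x y : P1 k) (P Q R W q : {poly k}).
Implicit Types (a b c l m : k).

(** The numerator of the derivative of P / Q. *)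
Definition wronskian P Q : {poly k} := P^`() * Q - P * Q^`().

Lemma wronskian_subZ c P Q : wronskian (P - c *: Q) Q = wronskian P Q.
Proof. rewrite /wronskian derivB derivZ -!mul_polyC; ring. Qed.

Lemma wronskianZ c P Q : wronskian (c *: P) (c *: Q) = c ^+ 2 *: wronskian P Q.
Proof. rewrite /wronskian !derivZ -!mul_polyC rmorphXn; ring. Qed.

Lemma dvdp_deriv R n q : R ^+ n %| q -> R ^+ n.-1 %| q^`().
Proof.
case: n => [|n]; first by rewrite expr0 !dvd1p.
move=> /dvdpP[u ->]; rewrite derivM deriv_exp /= dvdp_add //.
  by rewrite exprS mulrA dvdp_mull.
by rewrite -mulr_natr !mulrA dvdp_mulr // dvdp_mull.
Qed.

Lemma dvdp_wronskian R n P Q : R ^+ n %| P -> R ^+ n.-1 %| wronskian P Q.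
Proof.
move=> h; rewrite dvdp_sub // dvdp_mulr ?dvdp_deriv //.
by apply: dvdp_trans h; rewrite dvdp_exp2l // leq_pred.
Qed.

Lemma wronskianC P Q : wronskian P Q = - wronskian Q P.
Proof. rewrite /wronskian; ring. Qed.

(** The Wronskian vanishes at a to order at least the ramification index minus
    one, whether or not a is a pole. *)
Lemma ram_index_wronskian f a : nonconst f ->
  ('X - a%:P) ^+ (ram_index f (Some a)).-1 %| wronskian (numer f) (denom f).
Proof.
move=> ncf; case e: (evalr f (Some a)) => [c|].
  rewrite -(wronskian_subZ c); apply: dvdp_wronskian.
  by rewrite (ram_index_finite ncf e) -mup_geq // nonconst_num_neq0.
rewrite wronskianC dvdpNr; apply: dvdp_wronskian.
by rewrite (ram_index_pole ncf e) -mup_geq // denom_neq0.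
Qed.

Lemma wronskian_nonconst f : wronskian (numer f) (denom f) != 0 -> nonconst f.
Proof.
move=> W0 c; apply/negP => /eqP fE; move: W0.
have := numer_denomE f => /eqP; rewrite {1}fE -[rconst c]divr1 -rpoly1.
rewrite eq_frac ?oner_eq0 ?denom_neq0 // mulr1 => /eqP <-.
rewrite mul_polyC -(wronskian_subZ c) subrr /wronskian.
by rewrite deriv0 !mul0r subr0 eqxx.
Qed.

(** A nonzero Wronskian makes f separable: N(T) - f D(T) and its
    derivative generate an ideal containing the Wronskian W(T), which has
    constant roots, whereas N(T) - f D(T) has none. *)
Lemma wronskian_separable f :
  wronskian (numer f) (denom f) != 0 -> separable_cover f.
Proof.
move=> W0; have ncf := wronskian_nonconst W0.
set W := wronskian _ _ in W0; rewrite /separable_cover separable_poly.unlock.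
set q := _ - _.
have qE : q^`() = map_poly (@rconst k) (numer f)^`() -
                  f *: map_poly (@rconst k) (denom f)^`().
  by rewrite derivB derivZ !deriv_map.
have cW : coprimep q (map_poly (@rconst k) W).
  have [r ->] := closed_field_poly_normal W.
  rewrite map_polyZ.
  have l0 : rconst (lead_coef W) != 0 by rewrite rconst_eq0 lead_coef_eq0.
  rewrite (eqp_coprimepr _ (eqp_scale _ l0)).
  rewrite rmorph_prod /=; elim: r => [|z r ih]; first by rewrite big_nil coprimep1.
  rewrite big_cons coprimepMr ih andbT map_polyXsubC coprimep_XsubC.
  apply/negP; rewrite /root /q hornerD hornerN hornerZ !horner_map.
  rewrite subr_eq0 => /eqP e.
  have [D0|D0] := eqVneq (denom f).[z] 0.
    move/eqP: e; rewrite /= D0 rconst0 mulr0 rconst_eq0 => /eqP N0.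
    have := coprimep_root (coprime_numer_denom f) (x := z).
    by rewrite /root N0 eqxx => /(_ isT); rewrite D0 eqxx.
  have := ncf ((numer f).[z] / (denom f).[z]).
  have rD : rconst (denom f).[z] != 0 by rewrite rconst_eq0.
  rewrite -(inj_eq (mulIf rD)) -[f * _]e.
  by rewrite /rconst -rpolyM -polyCM divfK // eqxx.
apply/coprimepP => u uq uq'.
apply: (coprimepP _ _ cW) => //.
have -> : map_poly (@rconst k) W = q^`() * map_poly (@rconst k) (denom f)
    - q * map_poly (@rconst k) (denom f)^`().
  rewrite qE /q /W /wronskian rmorphB !rmorphM /= -!mul_polyC; ring.
by rewrite dvdp_sub // dvdp_mulr.
Qed.


Lemma degree_lowest_terms P Q : Q != 0 -> coprimep P Q ->
  degree (rpoly P / rpoly Q) = (maxn (size P) (size Q)).-1.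
Proof.
move=> Q0 cPQ; have [c c0 [nE dE]] := lowest_terms Q0 cPQ erefl.
by rewrite /degree nE dE !size_scale.
Qed.

Lemma nroot_expXsubC a b n : b != a -> ~~ root (('X - a%:P) ^+ n) b.
Proof.
by move=> ba; rewrite /root horner_exp hornerXsubC expf_neq0 // subr_eq0.
Qed.

Lemma scaler_mulC c P Q : c *: (P * Q) = P * (c *: Q).
Proof. by rewrite -!mul_polyC mulrCA. Qed.

(** The ramification index at a is at least the order of a as a zero of P - c Q
    and at most one more than its order as a zero of the Wronskian; here both
    bounds are n + 1. *)
Lemma ram_index_between P Q a c n q :
  Q != 0 -> coprimep P Q -> wronskian P Q = ('X - a%:P) ^+ n * q ->
  ~~ root q a -> ('X - a%:P) ^+ n.+1 %| P - c *: Q ->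
  evalr (rpoly P / rpoly Q) (Some a) = Some c /\
  ram_index (rpoly P / rpoly Q) (Some a) = n.+1.
Proof.
move=> Q0 cPQ WE qa dvd; set f := rpoly P / rpoly Q.
have q0 : q != 0 by apply: contraNneq qa => ->; rewrite root0.
have W0 : wronskian P Q != 0.
  by rewrite WE mulf_neq0 // expf_neq0 // polyXsubC_eq0.
have [u u0 [nE dE]] := lowest_terms Q0 cPQ (erefl f).
have Wf0 : wronskian (numer f) (denom f) != 0.
  by rewrite nE dE wronskianZ scaler_eq0 negb_or expf_neq0.
have ncf := wronskian_nonconst Wf0.
have ra : root (P - c *: Q) a.
  by rewrite -dvdp_XsubCl (dvdp_trans _ dvd) // dvdp_exp.
have Pa : P.[a] = c * Q.[a].
  by apply/eqP; rewrite -subr_eq0 -hornerZ -hornerN -hornerD.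
have Qa : Q.[a] != 0.
  apply/eqP => Qa; have := coprimep_root cPQ (x := a).
  by rewrite /root Pa Qa mulr0 eqxx => /(_ isT).
have ev : evalr f (Some a) = Some c.
  rewrite (evalr_lowest_terms _ Q0 cPQ erefl) /root (negPf Qa) Pa.
  by rewrite mulfK.
split=> //; apply/eqP; rewrite eqn_leq; apply/andP; split.
  have := ram_index_wronskian a ncf; rewrite nE dE wronskianZ.
  rewrite dvdpZr ?expf_neq0 // -mup_geq // WE mupM ?expf_neq0 ?polyXsubC_eq0 //.
  rewrite mup_XsubCX eqxx (mupNroot qa) addn0.
  by case: (ram_index f _).
rewrite (ram_index_finite ncf ev) mup_geq ?nonconst_num_neq0 //.
by rewrite nE dE scalerA mulrC -scalerA -scalerBr dvdpZr.
Qed.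

(** If the Wronskian of P / Q vanishes only at 0, 1 and m, to the orders
    n1 - 1, n2 - 1 and n4 - 1, and f maps these points to 0, 1 and l with at
    least the indices n1, n2 and n4, then f = P / Q is a cover of the expected
    type: its ramified points are these three and oo, where the index n3 is the
    difference of the degrees; f is tame because all indices are nonzero in k. *)
Lemma has_type_wronskian P Q C d n1 n2 n3 n4 l m (f := rpoly P / rpoly Q) :
    Q != 0 -> coprimep P Q ->
    size P = d.+1 -> size Q = (d - n3).+1 -> (n3 <= d)%N ->
    C != 0 ->
    wronskian P Q =
      C *: ('X ^+ n1.-1 * ('X - 1%:P) ^+ n2.-1 * ('X - m%:P) ^+ n4.-1) ->
    'X ^+ n1 %| P -> ('X - 1%:P) ^+ n2 %| P - Q ->
    ('X - m%:P) ^+ n4 %| P - l *: Q ->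
    (1 < n1)%N -> (1 < n2)%N -> (1 < n3)%N -> (1 < n4)%N ->
    n1%:R != 0 :> k -> n2%:R != 0 :> k -> n3%:R != 0 :> k -> n4%:R != 0 :> k ->
    m != 0 -> m != 1 -> l != 0 -> l != 1 ->
  [/\ has_type d [:: n1; n2; n3; n4] (branch4 (Some l)) f,
      evalr f (pt0 k) = pt0 k, evalr f (pt1 k) = pt1 k,
      evalr f (ptoo k) = ptoo k & evalr f (Some m) = Some l] /\
  (forall x, ramified f x <-> x \in [:: pt0 k; pt1 k; ptoo k; Some m]).
Proof.
move=> Q0 cPQ sP sQ n3d C0 WE dvd0 dvd1 dvdm.
case: n1 n2 n4 WE dvd0 dvd1 dvdm => [|n1] // [|n2] // [|n4] //.
move=> WE dvd0 dvd1 dvdm n1gt n2gt n3gt n4gt n1k n2k n3k n4k m0 m1 l0 l1.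
rewrite [_.-1]/= [n2.+1.-1]/= [n4.+1.-1]/= in WE.
have X0 : 'X = 'X - 0%:P :> {poly k} by rewrite polyC0 subr0.
have nrt c q1 q2 : ~~ root q1 c -> ~~ root q2 c -> ~~ root (C *: (q1 * q2)) c.
  by move=> h1 h2; rewrite rootZ // rootM negb_or h1.
have [ev0 r0] : evalr f (Some 0) = Some 0 /\ ram_index f (Some 0) = n1.+1.
  apply: (ram_index_between (q := C *: (('X - 1%:P) ^+ n2 * ('X - m%:P) ^+ n4)));
    rewrite // -?X0.
  - by rewrite WE -mulrA scaler_mulC.
  - by apply: nrt; apply: nroot_expXsubC; rewrite eq_sym ?oner_eq0.
  - by rewrite scale0r subr0.
have [ev1 r1] : evalr f (Some 1) = Some 1 /\ ram_index f (Some 1) = n2.+1.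
  apply: (ram_index_between (q := C *: ('X ^+ n1 * ('X - m%:P) ^+ n4))) => //.
  - by rewrite WE -mulrA mulrCA scaler_mulC.
  - apply: nrt; last by apply: nroot_expXsubC; rewrite eq_sym.
    by rewrite X0; apply: nroot_expXsubC; rewrite oner_eq0.
  - by rewrite scale1r.
have [evm rm] : evalr f (Some m) = Some l /\ ram_index f (Some m) = n4.+1.
  apply: (ram_index_between (q := C *: ('X ^+ n1 * ('X - 1%:P) ^+ n2))) => //.
  - by rewrite WE mulrC scaler_mulC.
  - apply: nrt; last exact: nroot_expXsubC.
    by rewrite X0; apply: nroot_expXsubC.
have lt_sz : (size Q < size P)%N.
  rewrite sP sQ ltnS ltn_subrL (ltnW n3gt); exact: leq_trans (ltnW n3gt) n3d.
have evoo : evalr f None = None.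
  by rewrite (evalr_lowest_terms _ Q0 cPQ erefl) lt_sz.
have [u u0 [nE dE]] := lowest_terms Q0 cPQ (erefl f).
have WfE : wronskian (numer f) (denom f) = u ^+ 2 *: wronskian P Q.
  by rewrite nE dE wronskianZ.
have Wf0 : wronskian (numer f) (denom f) != 0.
  rewrite WfE WE !scaler_eq0 !mulf_eq0 !expf_eq0 !polyXsubC_eq0 polyX_eq0.
  by rewrite !andbF !orbF negb_or C0 (negPf u0) ?andbF.
have ncf := wronskian_nonconst Wf0.
have roo : ram_index f None = n3.
  by rewrite (ram_index_infty ncf evoo) nE dE !size_scale // sP sQ subSS subKn.
have unram a : a != 0 -> a != 1 -> a != m -> ram_index f (Some a) = 1%N.
  move=> a0 a1 am; have := ram_index_wronskian a ncf.
  have := ram_index_gt0 (Some a) ncf.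
  case: (ram_index f (Some a)) => [|[|r]] // _.
  rewrite WfE dvdpZr ?expf_neq0 // => h.
  have : 'X - a%:P %| wronskian P Q.
    by apply: dvdp_trans h; rewrite dvdp_exp.
  rewrite dvdp_XsubCl WE => /negPn/negP[].
  rewrite -mulrA; apply: nrt; first by rewrite X0; apply: nroot_expXsubC.
  by rewrite rootM negb_or !nroot_expXsubC.
have ram x : ramified f x <-> x \in [:: pt0 k; pt1 k; ptoo k; Some m].
  rewrite /ramified; split; last first.
    by rewrite !inE => /or4P[] /eqP ->; rewrite ?r0 ?r1 ?roo ?rm.
  case: x => [a|]; last by rewrite !inE eqxx !orbT.
  apply: contraLR; rewrite !inE !negb_or => /and4P[a0 a1 _ am].
  by rewrite unram.
have ramE x : ramified f x -> [\/ x = pt0 k, x = pt1 k, x = ptoo k | x = Some m].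
  move/ram; rewrite !inE => /or4P[] /eqP ->.
  - exact: Or41. - exact: Or42. - exact: Or43. - exact: Or44.
have degE : degree f = d.
  by rewrite degree_lowest_terms // sP sQ (maxn_idPl _) // ltnS leq_subr.
split=> //; split=> //; split.
- split.
  + by rewrite degE (leq_trans _ n3d) // (ltn_trans _ n3gt).
  + exact: wronskian_separable.
  + move=> [a|]; last by rewrite roo.
    have [->|a0] := eqVneq a 0; first by rewrite r0.
    have [->|a1] := eqVneq a 1; first by rewrite r1.
    have [->|am] := eqVneq a m; first by rewrite rm.
    by rewrite unram // oner_eq0.
- by rewrite degE.
- by [].
- move=> y; split.
    rewrite !inE => /or4P[] /eqP ->.
    + by exists (pt0 k); rewrite ram !inE eqxx.
    + by exists (pt1 k); rewrite ram !inE eqxx orbT.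
    + by exists (ptoo k); rewrite ram !inE eqxx !orbT.
    + by exists (Some m); rewrite ram !inE eqxx !orbT.
  case=> x [<-] /ramE[] ->.
  + by rewrite ev0 !inE eqxx.
  + by rewrite ev1 !inE eqxx orbT.
  + by rewrite evoo !inE eqxx !orbT.
  + by rewrite evm !inE eqxx !orbT.
have sl : l != 0 /\ l != 1 by [].
move=> [|[|[|[|]]]] //= _.
- exists (pt0 k); split=> // x ex /ramE[] // e; move: ex; rewrite e.
  + by rewrite ev1 => -[/eqP]; rewrite oner_eq0.
  + by rewrite evoo.
  + by rewrite evm => -[/eqP]; rewrite (negPf l0).
- exists (pt1 k); split=> // x ex /ramE[] // e; move: ex; rewrite e.
  + by rewrite ev0 => -[/eqP]; rewrite eq_sym oner_eq0.
  + by rewrite evoo.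
  + by rewrite evm => -[/eqP]; rewrite (negPf l1).
- exists (ptoo k); split=> // x ex /ramE[] // e; move: ex; rewrite e.
  + by rewrite ev0.
  + by rewrite ev1.
  + by rewrite evm.
- exists (Some m); split=> // x ex /ramE[] // e; move: ex; rewrite e.
  + by rewrite ev0 => -[/eqP]; rewrite eq_sym (negPf l0).
  + by rewrite ev1 => -[/eqP]; rewrite eq_sym (negPf l1).
  + by rewrite evoo.
Qed.

End Wronskian.

(** * Covers with a fourth ramified point *)

(** Throughout, N / D is a normalized cover of type (dt; e1, e2, p - e3) with
    branch points 0, 1, oo.  Only the orders of N at 0 and of N - D at 1 and the
    degrees dt of N and ds of D are used.  The covers to be counted have
    degree d. *)
Section FourthPoint.
Variables (p : nat) (k : closedFieldType) (e1 e2 e3 ds dt d : nat).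
Variables (N D : {poly k}).
Hypotheses (p_char : p \in [pchar k]).
Hypotheses (e1b : (1 < e1 < p)%N) (e2b : (1 < e2 < p)%N) (e3b : (1 < e3 < p)%N).
Hypotheses (dtE : dt = (ds + (p - e3))%N) (eE : (e1 + e2 = dt + ds + 1)%N).
Hypothesis (dE : (d + 1 = dt + e3)%N).
Hypotheses (sN : size N = dt.+1) (sD : size D = ds.+1) (cND : coprimep N D).
Hypotheses (dvdN0 : 'X ^+ e1 %| N) (dvdN1 : ('X - 1%:P) ^+ e2 %| N - D).
Implicit Types (P Q R q : {poly k}) (a b c l m : k).

Local Notation XC a := ('X - a%:P).

Lemma N_neq0 : N != 0. Proof. by rewrite -size_poly_gt0 sN. Qed.
Lemma D_neq0 : D != 0. Proof. by rewrite -size_poly_gt0 sD. Qed.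

Lemma natr_neq0 n : (0 < n < p)%N -> n%:R != 0 :> k.
Proof.
move=> /andP[n0 np]; rewrite -(dvdn_pcharf p_char); apply/negP => /(dvdn_leq n0).
by rewrite leqNgt np.
Qed.

Lemma deriv_eq0_natr q n : size q = n.+1 -> q^`() = 0 -> n%:R = 0 :> k.
Proof.
case: n => // n sq q'0.
have : q`_n.+1 * n.+1%:R == 0 by rewrite mulr_natr -coef_deriv q'0 coef0.
rewrite mulf_eq0 => /orP[|/eqP //].
have := lead_coef_eq0 q; rewrite lead_coefE sq /= => ->.
by rewrite -size_poly_eq0 sq.
Qed.

Lemma dvdp_deriv_eq0 q : q != 0 -> q %| q^`() -> q^`() = 0.
Proof.
move=> q0 dv; apply/eqP; have [//|q'0] := boolP (q^`() == 0).
by have := dvdp_leq q'0 dv; rewrite leqNgt lt_size_deriv.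
Qed.

(** Otherwise the derivatives of N and D both vanish, so p divides their degrees
    and the difference p - e3 of the degrees. *)
Lemma wronskian_neq0 : wronskian N D != 0.
Proof.
apply/negP => /eqP W0; have e : N^`() * D = N * D^`().
  by apply/eqP; rewrite -subr_eq0 -/(wronskian N D) W0.
have N'0 : N^`() = 0.
  apply: dvdp_deriv_eq0 N_neq0 _.
  by rewrite -(Gauss_dvdpl _ cND) e dvdp_mulr.
have D'0 : D^`() = 0.
  apply: dvdp_deriv_eq0 D_neq0 _.
  by rewrite -(Gauss_dvdpr _ (_ : coprimep D N)) 1?coprimep_sym // -e dvdp_mull.
have := deriv_eq0_natr sN N'0; rewrite dtE natrD (deriv_eq0_natr sD D'0) add0r.
apply/eqP/natr_neq0; move: e3b; clear; lia.
Qed.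

Lemma coprime_XC a b i j : a != b -> coprimep (XC a ^+ i) (XC b ^+ j).
Proof.
move=> ab; apply: coprimep_expl; apply: coprimep_expr.
by rewrite coprimep_XsubC root_XsubC eq_sym.
Qed.

Lemma X_XC : 'X = XC 0 :> {poly k}. Proof. by rewrite polyC0 subr0. Qed.

Lemma coprime_X b i j : b != 0 -> coprimep ('X ^+ i) (XC b ^+ j).
Proof. by move=> b0; rewrite [in 'X ^+ i]X_XC coprime_XC // eq_sym. Qed.

Lemma X_XC_exp n : 'X ^+ n = XC 0 ^+ n :> {poly k}.
Proof. by rewrite polyC0 subr0. Qed.

Lemma size_XC_exp a n : size (XC a ^+ n) = n.+1.
Proof. exact: size_exp_XsubC. Qed.

Lemma XC_exp_neq0 a n : XC a ^+ n != 0.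
Proof. by rewrite expf_neq0 // polyXsubC_eq0. Qed.

(** A polynomial with more zeros than its degree allows is zero; the same for
    two points below. *)
Lemma dvdp_XsubC3_eq0 q i j n a b c : a != b -> a != c -> b != c ->
  XC a ^+ i %| q -> XC b ^+ j %| q -> XC c ^+ n %| q ->
  (size q < (i + j + n).+1)%N -> q = 0.
Proof.
move=> ab ac bc h1 h2 h3 sq; apply/eqP; have [//|q0] := boolP (q == 0).
have cp : coprimep (XC a ^+ i * XC b ^+ j) (XC c ^+ n).
  by rewrite coprimepMl !coprime_XC.
have : XC a ^+ i * XC b ^+ j * XC c ^+ n %| q.
  by rewrite Gauss_dvdp // Gauss_dvdp ?coprime_XC // h1 h2.
move=> /(dvdp_leq q0).
rewrite !size_mul ?mulf_neq0 ?XC_exp_neq0 // !size_XC_exp => h.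
move: sq; rewrite ltnNge => /negP[]; apply: leq_trans h; clear; lia.
Qed.

Lemma dvdp_XsubC2_eq0 q i j a b : a != b ->
  XC a ^+ i %| q -> XC b ^+ j %| q -> (size q < (i + j).+1)%N -> q = 0.
Proof.
move=> ab h1 h2 sq; apply/eqP; have [//|q0] := boolP (q == 0).
have : XC a ^+ i * XC b ^+ j %| q by rewrite Gauss_dvdp ?coprime_XC // h1 h2.
move=> /(dvdp_leq q0).
rewrite !size_mul ?XC_exp_neq0 // !size_XC_exp => h.
by move: sq; rewrite ltnNge => /negP[]; apply: leq_trans h; clear; lia.
Qed.

(** The orders of N at 0 and N - D at 1 already account for the whole degree of
    the Wronskian. *)
Lemma wronskianE : exists2 C, C != 0 &
  wronskian N D = C *: ('X ^+ e1.-1 * XC 1 ^+ e2.-1).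
Proof.
have h1 : 'X ^+ e1.-1 %| wronskian N D by exact: dvdp_wronskian.
have h2 : XC 1 ^+ e2.-1 %| wronskian N D.
  by rewrite -(wronskian_subZ 1) scale1r; exact: dvdp_wronskian.
have : 'X ^+ e1.-1 * XC 1 ^+ e2.-1 %| wronskian N D.
  by rewrite Gauss_dvdp ?h1 ?h2 // coprime_X ?oner_eq0.
move=> /dvdp_size_eqp; set q := _ * _ => /esym.
have q0 : q != 0 by rewrite mulf_neq0 ?XC_exp_neq0 // expf_neq0 ?polyX_eq0.
have sq : size q = (dt + ds)%N.
  rewrite /q size_mul ?XC_exp_neq0 ?expf_neq0 ?polyX_eq0 // size_XC_exp size_polyXn.
  by move: e1b e2b eE; clear; lia.
have sW : (size (wronskian N D) <= dt + ds)%N.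
  rewrite (leq_trans (size_polyD _ _)) // size_polyN geq_max.
  have sN' : (size N^`() <= dt)%N by rewrite -ltnS -sN lt_size_deriv ?N_neq0.
  have sD' : (size D^`() <= ds)%N by rewrite -ltnS -sD lt_size_deriv ?D_neq0.
  apply/andP; split; apply: (leq_trans (size_polyMleq _ _)).
    by rewrite sD addnS /= leq_add2r.
  by rewrite sN addSn /= leq_add2l.
have -> : size q == size (wronskian N D).
  rewrite eqn_leq sq sW andbT -sq dvdp_leq ?wronskian_neq0 //.
  by rewrite Gauss_dvdp ?h1 ?h2 // coprime_X ?oner_eq0.
move=> /eqpP[[u v] /= /andP[u0 v0] e].
exists (u / v); first by rewrite mulf_neq0 ?invr_eq0.
by rewrite mulrC -scalerA e scalerA mulVf ?scale1r.
Qed.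

(** A pair with the same orders at 0 and 1 as N, D and no larger degrees is
    proportional to it: N D' - N' D has more zeros than its degree allows. *)
Lemma proportional (N' D' : {poly k}) :
  (size N' <= dt.+1)%N -> (size D' <= ds.+1)%N ->
  'X ^+ e1 %| N' -> XC 1 ^+ e2 %| N' - D' -> N * D' = N' * D.
Proof.
move=> sN' sD' h0 h1; apply/eqP; rewrite -subr_eq0; apply/eqP.
apply: (@dvdp_XsubC2_eq0 _ e1 e2 0 1).
- by rewrite eq_sym oner_eq0.
- by rewrite -X_XC dvdp_sub // dvdp_mulr.
- have -> : N * D' - N' * D = (N - D) * D' - (N' - D') * D by ring.
  by rewrite dvdp_sub // dvdp_mulr.
have h (A B : {poly k}) : (size A <= dt.+1)%N -> (size B <= ds.+1)%N ->
    (size (A * B)%R <= e1 + e2)%N.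
  move=> sA sB; apply: (leq_trans (size_polyMleq _ _)).
  by move: sA sB eE; clear; lia.
by rewrite ltnS (leq_trans (size_polyD _ _)) // size_polyN geq_max !h ?sN ?sD.
Qed.

(** The p-th power map permutes the roots of D, by uniqueness applied to the
    Frobenius conjugates of N and D. *)
Lemma frobenius_roots m : root D (m ^+ p) = root D m.
Proof.
pose F := pFrobenius_aut p_char; pose FP := map_poly F.
have dX e q : 'X ^+ e %| q -> 'X ^+ e %| FP q.
  by move=> /dvdpP[u ->]; rewrite /FP rmorphM /= map_polyXn dvdp_mull.
have F1 : F 1 = 1 by rewrite /F pFrobenius_autE expr1n.
have d1 e q : XC 1 ^+ e %| q -> XC 1 ^+ e %| FP q.
  move=> /dvdpP[u ->]; rewrite /FP rmorphM rmorphXn /= map_polyXsubC /= -/F F1.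
  by rewrite dvdp_mull.
have e : N * FP D = FP N * D.
  apply: proportional; rewrite ?size_map_poly ?sN ?sD //; first exact: dX.
  by rewrite -rmorphB; exact: d1.
have : D %| FP D.
  by rewrite -(Gauss_dvdpr _ (_ : coprimep D N)) 1?coprimep_sym // e dvdp_mull.
move=> /dvdp_size_eqp; rewrite size_map_poly eqxx => /esym /eqp_root rE.
have -> : m ^+ p = F m by rewrite /F pFrobenius_autE.
rewrite rE -[RHS](fmorph_root F); reflexivity.
Qed.

Lemma p_gt0 : (0 < p)%N. Proof. by move: e1b; clear; case: p => // /andP[]. Qed.

Lemma XpE a : 'X ^+ p - (a ^+ p)%:P = XC a ^+ p :> {poly k}.
Proof.
have pc : p \in [pchar {poly k}] by rewrite pchar_poly.
by rewrite rmorphXn -!(pFrobenius_autE pc) -rmorphB.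
Qed.

Lemma Xp1E : 'X ^+ p - 1 = XC 1 ^+ p :> {poly k}.
Proof. by rewrite -XpE expr1n polyC1. Qed.

(** Up to the factor x - m, these two combinations of N and D, with coefficients
    polynomials in x^p, are the denominator and the numerator of the cover with
    fourth ramified point m and fourth branch point l. *)
Definition den_form l m : {poly k} :=
  (m ^+ p - l) *: N + ((l - 1) * m ^+ p) *: D.

Definition num_form l m : {poly k} :=
  l *: ((m ^+ p - l) *: N + (l - 1) *: ('X ^+ p * D)).

Lemma size_den_form l m : (size (den_form l m) <= dt.+1)%N.
Proof.
rewrite (leq_trans (size_polyD _ _)) // geq_max.
rewrite !(leq_trans (size_scale_leq _ _)) ?sN ?sD //.
by rewrite ltnS dtE leq_addr.
Qed.

Lemma size_num_form_le a b :
  (size (a *: N + b *: ('X ^+ p * D))%R <= dt + e3 + 1)%N.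
Proof.
rewrite (leq_trans (size_polyD _ _)) // geq_max.
rewrite !(leq_trans (size_scale_leq _ _)) //.
  rewrite size_monicM ?monicXn ?D_neq0 // size_polyXn sD.
  by move: dtE e3b; clear; lia.
by rewrite sN addn1 ltnS leq_addr.
Qed.

Lemma degree_count : (e1 + e2 + p.-1 = d + dt + 1)%N.
Proof. by move: e1b e3b dtE eE dE; clear; lia. Qed.

(** A normalized cover with fourth ramified point m and fourth branch point l is
    determined by m and l, and m is constrained by l. *)
Lemma cover_forms f l m (P := numer f) (Q := denom f) : l != 0 -> l != 1 ->
    nonconst f -> (degree f <= d)%N ->
    evalr f (pt0 k) = pt0 k -> evalr f (pt1 k) = pt1 k ->
    evalr f (ptoo k) = ptoo k -> evalr f (Some m) = Some l ->
    ram_index f (pt0 k) = e1 -> ram_index f (pt1 k) = e2 ->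
    ram_index f (ptoo k) = e3 -> ram_index f (Some m) = p.-1 ->
  [/\ m != 0, m != 1, ~~ root D m, root (den_form l m) m &
      f = rpoly (num_form l m) / rpoly (den_form l m)].
Proof.
move=> l0 l1 ncf degf ev0 ev1 evoo evm r0 r1 roo rm.
have Q0 : Q != 0 := denom_neq0 f.
have P0 : P != 0 := numer_neq0 (nonconst_neq0 ncf).
have cPQ : coprimep P Q := coprime_numer_denom f.
have m0 : m != 0.
  by apply: contraNneq l0 => m0; move: evm; rewrite m0 -/(pt0 k) ev0 => -[<-].
have m1 : m != 1.
  by apply: contraNneq l1 => m1; move: evm; rewrite m1 -/(pt1 k) ev1 => -[<-].
have sPQ : (size P = size Q + e3)%N.
  have := ram_index_infty ncf evoo; rewrite roo => ->; rewrite subnKC //.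
  by move: evoo; rewrite /evalr; case: ifP => // /ltnW.
have sP : (size P <= d.+1)%N.
  move: degf; rewrite /degree (maxn_idPl _) -/P -/Q ?sPQ ?leq_addr //.
  by move: (size Q + e3)%N; clear; case.
have dvd0 : 'X ^+ e1 %| P.
  rewrite -[P]subr0 -[0](scale0r Q) X_XC -mup_geq ?nonconst_num_neq0 //.
  by rewrite -(ram_index_finite ncf ev0) r0.
have dvd1 : XC 1 ^+ e2 %| P - Q.
  rewrite -[Q]scale1r -mup_geq ?nonconst_num_neq0 //.
  by rewrite -(ram_index_finite ncf ev1) r1.
have mupm : mup m (P - l *: Q) = p.-1.
  by rewrite -(ram_index_finite ncf evm) rm.
have PlQ0 : P - l *: Q != 0 by rewrite nonconst_num_neq0.
have dvdm : XC m ^+ p.-1 %| P - l *: Q by rewrite -mup_geq // mupm.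
set c := m ^+ p.
pose Phi := P * den_form l m - l *: (Q * ((c - l) *: N + (l - 1) *: ('X ^+ p * D))).
(* Phi vanishes to orders e1, e2 and p - 1 at 0, 1 and m, and has degree at most
   d + dt. *)
have Phi0 : Phi = 0.
  apply: (@dvdp_XsubC3_eq0 _ e1 e2 p.-1 0 1 m); rewrite 1?eq_sym ?oner_eq0 //.
  - rewrite -X_XC /Phi /den_form dvdp_sub //; first by rewrite dvdp_mulr.
    rewrite -mul_polyC dvdp_mull // dvdp_mull // dvdp_add //.
      by rewrite -mul_polyC dvdp_mull.
    rewrite -mul_polyC dvdp_mull // dvdp_mulr // dvdp_exp2l //.
    by case/andP: e1b => _ /ltnW.
  - have -> : Phi = den_form l m * (P - Q)
        - (l - 1)%:P * Q * ((c - l)%:P * (N - D) + l%:P * ('X ^+ p - 1) * D).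
      rewrite /Phi /den_form -/c -!mul_polyC !polyCB !polyCM polyCB polyC1; ring.
    rewrite Xp1E dvdp_sub //; first by rewrite dvdp_mull.
    rewrite dvdp_mull // dvdp_add //; first by rewrite dvdp_mull.
    rewrite dvdp_mulr // dvdp_mull // dvdp_exp2l //.
    by case/andP: e2b => _ /ltnW.
  - have -> : Phi = den_form l m * (P - l *: Q)
        - (l * (l - 1))%:P * Q * D * ('X ^+ p - c%:P).
      rewrite /Phi /den_form -/c -!mul_polyC !polyCM !polyCB polyC1; ring.
    rewrite XpE dvdp_sub //; first by rewrite dvdp_mull.
    by rewrite dvdp_mull // dvdp_exp2l // leq_pred.
  rewrite degree_count ltnS.
  have bound (A B : {poly k}) i j : (size A <= i)%N -> (size B <= j)%N ->
      (size (A * B)%R <= (i + j).-1)%N.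
    move=> sA sB; apply: (leq_trans (size_polyMleq _ _)).
    by move: sA sB; clear; lia.
  rewrite /Phi (leq_trans (size_polyD _ _)) // size_polyN geq_max; apply/andP; split.
    apply: (leq_trans (bound _ _ _ _ sP (size_den_form l m))).
    by clear; lia.
  apply: (leq_trans (size_scale_leq _ _)).
  apply: (leq_trans (bound _ _ _ _ (leqnn _) (size_num_form_le _ _))).
  by move: sP; rewrite sPQ; clear; lia.
(* Otherwise P = x^p Q, so Q is constant and the index at oo is p. *)
have cl : c != l.
  apply/negP => /eqP cl; move: Phi0.
  have -> : Phi = (l * (l - 1)) *: (D * (P - 'X ^+ p * Q)).
    rewrite /Phi /den_form -/c cl subrr !scale0r !add0r -!mul_polyC !polyCM; ring.
  move/eqP; rewrite scaler_eq0 !mulf_eq0 (negPf l0) subr_eq0 (negPf l1).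
  rewrite (negPf D_neq0) /= subr_eq0 => /eqP PE.
  have sQ1 : size Q = 1%N.
    have : Q %| P by rewrite PE dvdp_mull.
    move=> QP; apply/eqP; move: cPQ; rewrite coprimep_sym => /coprimepP/(_ Q).
    by rewrite -size_poly_eq1; apply.
  have := sPQ; rewrite PE size_monicM ?monicXn // size_polyXn sQ1.
  by move: e3b; clear; lia.
(* At m the right-hand side vanishes to order at least p, the factor P - l Q to
   order exactly p - 1; so den_form l m vanishes there. *)
have GE : (P - l *: Q) * den_form l m = (l * (l - 1)) *: (Q * D * XC m ^+ p).
  have <- : Phi + (l * (l - 1)) *: (Q * D * XC m ^+ p) =
      (P - l *: Q) * den_form l m.
    rewrite -XpE /Phi /den_form -/c -!mul_polyC !polyCM !polyCB polyC1; ring.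
  by rewrite Phi0 add0r.
have G0 : den_form l m != 0.
  apply: contra_eq_neq GE => ->; rewrite mulr0 eq_sym scaler_eq0 !mulf_eq0.
  rewrite (negPf l0) subr_eq0 (negPf l1) (negPf Q0) (negPf D_neq0) /=.
  exact: XC_exp_neq0.
have Gm : root (den_form l m) m.
  rewrite -dvdp_XsubCl XsubC_dvd //.
  have : XC m ^+ p %| (P - l *: Q) * den_form l m.
    by rewrite GE -mul_polyC mulrA dvdp_mull.
  rewrite -mup_geq ?mulf_neq0 // mupM // mupm.
  by move: (mup m _) p_gt0; clear; lia.
have Dm : ~~ root D m.
  apply/negP => Dm; have /negP[] : ~~ root N m.
    by apply/negP => Nm; have := coprimep_root cND Nm; rewrite (eqP Dm) eqxx.
  move: Gm; rewrite /root /den_form hornerD !hornerZ (eqP Dm) mulr0 addr0.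
  by rewrite mulf_eq0 subr_eq0 (negPf cl).
split=> //; rewrite [f]numer_denomE; apply/eqP.
rewrite eq_frac // -subr_eq0 -[0]Phi0 /Phi /num_form -/c -/P -/Q.
by rewrite -!mul_polyC -mulrA [_ * Q]mulrC.
Qed.

(** The cover with fourth branch point l and fourth ramified point m, provided
    that den_form l m vanishes at m and D does not; the fraction is then not in
    lowest terms, since x - m divides both forms. *)
Definition fourth_cover l m : ratfun k :=
  rpoly (num_form l m) / rpoly (den_form l m).

Lemma coprimep_noroot P Q : (forall z, root P z -> root Q z -> False) ->
  coprimep P Q.
Proof.
move=> h; rewrite /coprimep; apply/negPn/negP => /closed_rootP[z].
by rewrite root_gcd => /andP[/h h1 /h1].
Qed.

Lemma deriv_Xp : ('X ^+ p : {poly k})^`() = 0.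
Proof. by rewrite derivXn -mulr_natr -polyC_natr (pcharf0 p_char) mulr0. Qed.

Lemma wronskian_forms l m : wronskian (num_form l m) (den_form l m) =
  - (l * (l - 1) * (m ^+ p - l)) *: (XC m ^+ p * wronskian N D).
Proof.
rewrite -XpE /num_form /den_form; set c := m ^+ p.
rewrite /wronskian !derivZ !derivD !derivZ derivM deriv_Xp mul0r add0r.
rewrite -!mul_polyC polyCN !polyCM !polyCB polyC1; ring.
Qed.

Lemma wronskianMl R P Q : wronskian (R * P) (R * Q) = R ^+ 2 * wronskian P Q.
Proof. rewrite /wronskian !derivM; ring. Qed.

Lemma den_form_wronskian l m :
  wronskian (den_form l m) D = (m ^+ p - l) *: wronskian N D.
Proof. rewrite /wronskian /den_form derivD !derivZ -!mul_polyC; ring. Qed.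

Lemma num_sub_den l m : num_form l m - l *: den_form l m =
  (l * (l - 1)) *: (D * XC m ^+ p).
Proof.
rewrite -XpE /num_form /den_form -!mul_polyC !polyCM !polyCB polyC1; ring.
Qed.

Lemma root_subZ l m P Q : root (P - l *: Q) m -> root Q m -> root P m.
Proof.
move=> + /eqP Qm; rewrite /root hornerD hornerN hornerZ Qm mulr0 subr0.
exact.
Qed.

Lemma fourth_cover_has_type l m : l != 0 -> l != 1 -> m != 0 -> m != 1 ->
    ~~ root D m -> root (den_form l m) m ->
  [/\ has_type d [:: e1; e2; e3; p.-1] (branch4 (Some l)) (fourth_cover l m),
      evalr (fourth_cover l m) (pt0 k) = pt0 k,
      evalr (fourth_cover l m) (pt1 k) = pt1 k,
      evalr (fourth_cover l m) (ptoo k) = ptoo k &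
      evalr (fourth_cover l m) (Some m) = Some l] /\
  (forall x, ramified (fourth_cover l m) x <->
     x \in [:: pt0 k; pt1 k; ptoo k; Some m]).
Proof.
move=> l0 l1 m0 m1 Dm Gm.
have [C C0 WE] := wronskianE.
have W0m : ~~ root (wronskian N D) m.
  rewrite WE rootZ // rootM negb_or nroot_expXsubC // andbT.
  by rewrite X_XC_exp nroot_expXsubC.
have cl : m ^+ p != l.
  apply: contraNneq Dm => cl; move: Gm.
  rewrite /den_form cl subrr scale0r add0r rootZ //.
  by rewrite mulf_neq0 // subr_eq0.
have psz : (p = p.-1.+1)%N by rewrite prednK // p_gt0.
have Fm : root (num_form l m) m.
  apply: (root_subZ (l := l) (Q := den_form l m)) => //.
  rewrite num_sub_den // rootZ ?mulf_neq0 ?subr_eq0 // rootM.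
  by rewrite {1}psz root_exp_XsubC eqxx orbT.
have [P PE] : exists P, num_form l m = XC m * P.
  by move: Fm; rewrite -dvdp_XsubCl => /dvdpP[P ->]; exists P; rewrite mulrC.
have [Q QE] : exists Q, den_form l m = XC m * Q.
  by move: Gm; rewrite -dvdp_XsubCl => /dvdpP[Q ->]; exists Q; rewrite mulrC.
have X0 : XC m != 0 by rewrite polyXsubC_eq0.
have PlQ : P - l *: Q = (l * (l - 1)) *: (D * XC m ^+ p.-1).
  apply: (mulfI X0); have h := num_sub_den l m.
  rewrite PE QE psz exprS in h; move: h; move: (XC m ^+ _) => Y h.
  transitivity (XC m * P - l *: (XC m * Q)); first by rewrite -!mul_polyC; ring.
  by rewrite h -!mul_polyC; ring.
have sden : size (den_form l m) = dt.+1.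
  have sz1 : size ((m ^+ p - l) *: N) = dt.+1 by rewrite size_scale ?subr_eq0.
  rewrite /den_form size_polyDl sz1 //.
  apply: leq_ltn_trans (size_scale_leq _ _) _; rewrite sD ltnS.
  by move: dtE e3b; clear; lia.
have snum : size (num_form l m) = (dt + e3 + 1)%N.
  have sz2 : size ((l - 1) *: ('X ^+ p * D)) = (dt + e3 + 1)%N.
    rewrite size_scale ?subr_eq0 // size_monicM ?monicXn ?D_neq0 // size_polyXn sD.
    by move: dtE e3b; clear; lia.
  rewrite /num_form size_scale // addrC size_polyDl sz2 //.
  apply: leq_ltn_trans (size_scale_leq _ _) _; rewrite sN.
  by move: e3b; clear; lia.
have Q0 : Q != 0.
  by apply/eqP => Q0; move: sden; rewrite QE Q0 mulr0 size_poly0.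
have P0 : P != 0.
  by apply/eqP => P0; move: snum; rewrite PE P0 mulr0 size_poly0 addn1.
have sP : size P = d.+1.
  move: snum; rewrite PE size_mul // size_XsubC.
  by move: dE (size P); clear; lia.
have sQ : size Q = (d - e3).+1.
  move: sden; rewrite QE size_mul // size_XsubC.
  by move: dE dtE e3b (size Q); clear; lia.
have fE : fourth_cover l m = rpoly P / rpoly Q.
  rewrite /fourth_cover; apply/eqP; rewrite eq_frac //.
    by rewrite PE QE mulrCA mulrA.
  by rewrite QE mulf_neq0.
have cPQ : coprimep P Q.
  apply: coprimep_noroot => z Pz Qz.
  have denz : root (den_form l m) z by rewrite QE rootM Qz orbT.
  have [zm|zm] := eqVneq z m.
    have : XC m ^+ 2 %| den_form l m.
      by rewrite QE exprS expr1 dvdp_mul2l // dvdp_XsubCl -zm.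
    move=> /(dvdp_wronskian D); rewrite den_form_wronskian expr1 dvdp_XsubCl.
    by rewrite rootZ ?subr_eq0 // (negPf W0m).
  have : root (P - l *: Q) z.
    by rewrite /root hornerD hornerN hornerZ (eqP Pz) (eqP Qz) mulr0 subr0.
  rewrite PlQ rootZ ?mulf_neq0 ?subr_eq0 // rootM (negPf (nroot_expXsubC _ zm)) orbF.
  move=> Dz; have : root (den_form l m - ((l - 1) * m ^+ p) *: D) z.
    by rewrite /root hornerD hornerN (eqP denz) hornerZ (eqP Dz) mulr0 subr0.
  rewrite /den_form addrK rootZ ?subr_eq0 // => Nz.
  by have := coprimep_root cND Nz; rewrite (eqP Dz) eqxx.
have WPQ : wronskian P Q = (- (l * (l - 1) * (m ^+ p - l)) * C) *:
    ('X ^+ e1.-1 * XC 1 ^+ e2.-1 * XC m ^+ p.-1.-1).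
  apply: (mulfI (expf_neq0 2 X0)); rewrite -wronskianMl -PE -QE wronskian_forms WE.
  have -> : XC m ^+ p = XC m ^+ 2 * XC m ^+ p.-1.-1.
    by rewrite -exprD; congr (_ ^+ _); move: e1b; clear; lia.
  move: (XC m ^+ 2) (XC m ^+ p.-1.-1) ('X ^+ e1.-1) (XC 1 ^+ e2.-1) => Y1 Y2 Y3 Y4.
  by rewrite -!mul_polyC [(- _ * C)%:P]polyCM; ring.
rewrite fE; apply: (has_type_wronskian Q0 cPQ sP sQ _ _ WPQ).
- by move: dE dtE e3b; clear; lia.
- by rewrite mulf_neq0 // oppr_eq0 !mulf_neq0 // subr_eq0.
- rewrite -(Gauss_dvdpr _ (coprime_X e1 1 m0)) expr1 -PE /num_form.
  rewrite -mul_polyC dvdp_mull // dvdp_add //.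
    by rewrite -mul_polyC dvdp_mull.
  rewrite -mul_polyC dvdp_mull // dvdp_mulr // dvdp_exp2l //.
  by case/andP: e1b => _ /ltnW.
- have m1' : 1 != m by rewrite eq_sym.
  rewrite -(Gauss_dvdpr _ (coprime_XC e2 1 m1')) expr1 mulrBr -PE -QE.
  have -> : num_form l m - den_form l m =
     (l - 1)%:P * ((m ^+ p - l)%:P * (N - D) + l%:P * ('X ^+ p - 1) * D).
    rewrite /num_form /den_form -!mul_polyC !polyCM !polyCB polyC1; ring.
  rewrite Xp1E dvdp_mull // dvdp_add //; first by rewrite dvdp_mull.
  rewrite dvdp_mulr // dvdp_mull // dvdp_exp2l //.
  by case/andP: e2b => _ /ltnW.
- by rewrite PlQ -mul_polyC mulrA dvdp_mull.
all: rewrite ?natr_neq0 //; try (by case/andP: e1b); try (by case/andP: e2b);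
  try (by case/andP: e3b).
- by move: e1b; clear; lia.
- by move: e1b; clear; lia.
- by move: e2b; clear; lia.
- by move: e3b; clear; lia.
- by move: e1b; clear; lia.
Qed.

(** * Counting the covers *)

(** The form den_form l m vanishes at m if and only if m is a zero of this
    polynomial, which depends on l only. *)
Definition point_poly l : {poly k} :=
  ('X ^+ p - l%:P) * N + (l - 1)%:P * ('X ^+ p * D).

Lemma root_point_poly l m : root (point_poly l) m = root (den_form l m) m.
Proof.
by rewrite /root /point_poly /den_form !hornerE ?mulrA.
Qed.

Lemma wronskian_point_poly_den l :
  wronskian (point_poly l) D = ('X ^+ p - l%:P) * wronskian N D.
Proof.
rewrite /wronskian /point_poly derivD !derivM derivB !derivC deriv_Xp; ring.
Qed.

Lemma wronskian_point_poly_num l :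
  wronskian (point_poly l) N = - ((l - 1)%:P * ('X ^+ p * wronskian N D)).
Proof.
rewrite /wronskian /point_poly derivD !derivM derivB !derivC deriv_Xp; ring.
Qed.

Lemma size_point_poly l : size (point_poly l) = (p + dt).+1.
Proof.
have sz1 : size ('X ^+ p * N) = (p + dt).+1.
  by rewrite size_monicM ?monicXn ?N_neq0 // size_polyXn sN /= addnS.
have -> : point_poly l = 'X ^+ p * N + (- l *: N + (l - 1) *: ('X ^+ p * D)).
  rewrite /point_poly -!mul_polyC polyCN; ring.
rewrite size_polyDl sz1 //.
rewrite (leq_ltn_trans (size_polyD _ _)) // gtn_max; apply/andP; split.
  apply: leq_ltn_trans (size_scale_leq _ _) _; rewrite sN.
  by move: e1b; clear; lia.
apply: leq_ltn_trans (size_scale_leq _ _) _.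
rewrite size_monicM ?monicXn ?D_neq0 // size_polyXn sD.
by move: e3b dtE; clear; lia.
Qed.

Lemma mup_wronskian a R Q : R != 0 -> wronskian R Q != 0 ->
  (mup a R <= (mup a (wronskian R Q)).+1)%N.
Proof.
move=> R0 W0; have : XC a ^+ mup a R %| R by rewrite -mup_geq.
move=> /(dvdp_wronskian Q); rewrite -mup_geq //.
by case: (mup a R).
Qed.

Lemma mup_wronskianE a :
  mup a (wronskian N D) = ((a == 0%R) * e1.-1 + (a == 1%R) * e2.-1)%N.
Proof.
have [C C0 ->] := wronskianE.
rewrite -mul_polyC mupMr ?rootC // X_XC_exp mupM ?XC_exp_neq0 //.
rewrite !mup_XsubCX ![_ == a]eq_sym.
by case: (a == 0); case: (a == 1); rewrite ?mul1n ?mul0n.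
Qed.

(** The multiplicities come from the Wronskians of point_poly l with D and with
    N: the former controls the zero 0, the latter all the others. *)
Lemma mup_point_poly l a : l != 0 -> l != 1 -> mup a (point_poly l) =
  if a == 0 then e1 else if a == 1 then e2 else root (point_poly l) a.
Proof.
move=> l0 l1.
have R0 : point_poly l != 0 by rewrite -size_poly_gt0 size_point_poly.
have W0 := wronskian_neq0.
have Xl0 : 'X ^+ p - l%:P != 0 :> {poly k}.
  rewrite -size_poly_gt0 size_XnsubC ?p_gt0 //.
have l10 : (l - 1)%:P != 0 :> {poly k} by rewrite polyC_eq0 subr_eq0.
have [->|a0] := eqVneq a 0.
  apply/eqP; rewrite eqn_leq; apply/andP; split.
    have := @mup_wronskian 0 (point_poly l) D R0.
    rewrite wronskian_point_poly_den mulf_neq0 // => /(_ isT).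
    rewrite mupMr; last first.
      rewrite /root hornerD hornerN hornerC hornerXn expr0n (gtn_eqF p_gt0).
      by rewrite sub0r oppr_eq0.
    rewrite mup_wronskianE eqxx eq_sym oner_eq0 mul1n addn0.
    by rewrite prednK //; move: e1b; clear; lia.
  rewrite mup_geq // -X_XC /point_poly dvdp_add //; first by rewrite dvdp_mull.
  rewrite dvdp_mull // dvdp_mulr // dvdp_exp2l //.
  by case/andP: e1b => _ /ltnW.
have le1 : (mup a (point_poly l) <= ((a == 1%R) * e2.-1).+1)%N.
  have := @mup_wronskian a (point_poly l) N R0.
  rewrite wronskian_point_poly_num oppr_eq0.
  have X0 : 'X ^+ p != 0 :> {poly k} by rewrite expf_neq0 ?polyX_eq0.
  rewrite !mulf_neq0 // => /(_ isT).
  have -> : - ((l - 1)%:P * ('X ^+ p * wronskian N D)) =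
     ((1 - l)%:P * 'X ^+ p) * wronskian N D by rewrite !polyCB; ring.
  rewrite mupMr; last first.
    rewrite /root hornerM hornerC hornerXn mulf_neq0 ?expf_neq0 //.
    by rewrite subr_eq0 eq_sym.
  by rewrite mup_wronskianE (negPf a0) mul0n add0n.
have [a1|a1] := eqVneq a 1.
  move: le1; rewrite a1 eqxx mul1n => le1; apply/eqP; rewrite eqn_leq.
  apply/andP; split; first by apply: leq_trans le1 _; move: e2b; clear; lia.
  rewrite mup_geq //.
  have -> : point_poly l = ('X ^+ p - l%:P) * (N - D) + l%:P * ('X ^+ p - 1) * D.
    rewrite /point_poly !polyCB polyC1; ring.
  rewrite Xp1E dvdp_add //; first by rewrite dvdp_mull.
  rewrite dvdp_mulr // dvdp_mull // dvdp_exp2l //.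
  by case/andP: e2b => _ /ltnW.
move: le1; rewrite (negPf a1) mul0n -dvdp_XsubCl XsubC_dvd //.
by case: (mup a _) => [|[|]].
Qed.

(** The candidates for the fourth ramified point above l; their number does not
    depend on l. *)
Lemma points_exist l : l != 0 -> l != 1 -> exists s : seq k,
  [/\ uniq s, size s = (p + dt - (e1 + e2))%N &
      forall m, (m \in s) = [&& m != 0, m != 1 & root (den_form l m) m]].
Proof.
move=> l0 l1; have [r rE] := closed_field_poly_normal (point_poly l).
set R := point_poly l in rE.
have R0 : R != 0 by rewrite -size_poly_gt0 size_point_poly.
have lc0 : lead_coef R != 0 by rewrite lead_coef_eq0.
have cE a : count_mem a r = mup a R.
  by rewrite [in RHS]rE -mul_polyC mupMr ?rootC // mu_prod_XsubC.
have rootE a : (a \in r) = root R a.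
  by rewrite rE rootZ // root_prod_XsubC.
have szr : size r = (p + dt)%N.
  have := size_point_poly l; rewrite -/R rE size_scale //.
  by rewrite size_prod_XsubC => -[].
pose good := [pred a : k | (a != 0) && (a != 1)].
exists (filter good r); split.
- apply: count_mem_uniq => a; rewrite mem_filter count_filter.
  have [ga|ga] /= := boolP (good a).
    rewrite rootE; have := mup_point_poly a l0 l1; rewrite -/R.
    move: (ga) => /andP[/negPf -> /negPf ->] <-; rewrite -cE.
    by apply: eq_count => b /=; case: eqP => // ->.
  apply/eqP; rewrite -leqn0 leqNgt -has_count; apply/negP => /hasP[b _ /=].
  by move=> /andP[/eqP ->]; apply/negP.
- rewrite size_filter -szr.
  have -> : (e1 + e2 = count_mem 0%R r + count_mem 1%R r)%N.
    by rewrite !cE !mup_point_poly // eqxx eqxx oner_eq0.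
  suff -> : size r = (count good r + (count_mem 0%R r + count_mem 1%R r))%N.
    by rewrite addnK.
  elim: (r) => //= a t ->.
  have [->|a0] := eqVneq a 0; first by rewrite eq_sym oner_eq0 /=; clear; lia.
  by case: (a == 1) => /=; clear; lia.
- by move=> m; rewrite mem_filter rootE root_point_poly /= andbA.
Qed.

Lemma fourth_cover_inj l m m' : l != 0 -> l != 1 ->
  m != 0 -> m != 1 -> ~~ root D m -> root (den_form l m) m ->
  m' != 0 -> m' != 1 -> ~~ root D m' -> root (den_form l m') m' ->
  iso_class (fourth_cover l m) = iso_class (fourth_cover l m') -> m = m'.
Proof.
move=> l0 l1 m0 m1 Dm Gm m0' m1' Dm' Gm' /iso_class_inj.
have [[ty ev0 ev1 evoo evm] ram] := fourth_cover_has_type l0 l1 m0 m1 Dm Gm.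
have [[ty' ev0' ev1' evoo' evm'] ram'] :=
  fourth_cover_has_type l0 l1 m0' m1' Dm' Gm'.
case=> i [i' [mi fE]].
set f := fourth_cover l m in ev0 ev1 evoo evm ram fE ty.
set f' := fourth_cover l m' in ev0' ev1' evoo' evm' ram' fE ty'.
have ncf' : nonconst f' by apply: nonconst_degree; case: ty' => [[]].
have [nci _] := mutually_inverse_nonconst mi.
have evi x : evalr f' (evalr i x) = evalr f x by rewrite -fE evalr_comp.
have rami x : ramified f x -> evalr i x \in [:: pt0 k; pt1 k; ptoo k; Some m'].
  rewrite -ram' /ramified -fE ram_index_comp //.
  by rewrite (mutually_inverse_ram_index _ mi) muln1.
have l0' : Some l <> pt0 k by case=> /eqP; rewrite (negPf l0).
have l1' : Some l <> pt1 k by case=> /eqP; rewrite (negPf l1).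
(* As f' o i = f, the automorphism i sends the ramified point of f above a branch
   point to the ramified point of f' above it. *)
have i0 : evalr i (pt0 k) = pt0 k.
  have := evi (pt0 k); rewrite ev0.
  have /rami : ramified f (pt0 k) by rewrite ram !inE eqxx.
  by rewrite !inE => /or4P[] /eqP -> //; rewrite ?ev1' ?evoo' ?evm' //.
have i1 : evalr i (pt1 k) = pt1 k.
  have := evi (pt1 k); rewrite ev1.
  have /rami : ramified f (pt1 k) by rewrite ram !inE eqxx orbT.
  by rewrite !inE => /or4P[] /eqP -> //; rewrite ?ev0' ?evoo' ?evm' //.
have ioo : evalr i (ptoo k) = ptoo k.
  have := evi (ptoo k); rewrite evoo.
  have /rami : ramified f (ptoo k) by rewrite ram !inE eqxx !orbT.
  by rewrite !inE => /or4P[] /eqP -> //; rewrite ?ev0' ?ev1' ?evm'.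
have iX := mutually_inverse_fix3 mi i0 i1 ioo.
have ff' : f' = f by rewrite -fE iX comp_rat_id.
have : ramified f' (Some m) by rewrite ff' ram !inE eqxx !orbT.
rewrite ram' !inE => /or4P[] /eqP; rewrite /pt0 /pt1 /ptoo.
- by case=> /eqP; rewrite (negPf m0).
- by case=> /eqP; rewrite (negPf m1).
- by [].
- by case.
Qed.

Local Notation es := [:: e1; e2; e3; p.-1].

(** The isomorphism classes of covers above l correspond to the candidates that
    are not zeros of D. *)
Lemma num_coversE l s : l != 0 -> l != 1 -> uniq s ->
    (forall m, (m \in s) = [&& m != 0, m != 1 & root (den_form l m) m]) ->
  num_covers d es (branch4 (Some l)) = count (fun m => ~~ root D m) s.
Proof.
move=> l0 l1 us sE; rewrite -size_filter; set s' := filter _ s.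
have s'E m : m \in s' -> [/\ m != 0, m != 1, ~~ root D m & root (den_form l m) m].
  by rewrite mem_filter sE => /and4P[].
pose t := [seq iso_class (fourth_cover l m) | m <- s'].
have ut : uniq t.
  rewrite map_inj_in_uniq ?filter_uniq // => m m'.
  move=> /s'E[m0 m1 Dm Gm] /s'E[m0' m1' Dm' Gm'].
  exact: fourth_cover_inj.
rewrite /num_covers.
suff -> : iso_classes d es (branch4 (Some l)) = [set` [fset x | x in t]%fset].
  by rewrite set_fsetK card_fseq undup_id // size_map.
apply/seteqP; split=> X /=.
  case=> f ty <-.
  have [g [m [fg [ncg [dg [[ev0 ev1 evoo evm] [r0 r1 roo rm]]]]]]] :=
    normalize_cover l0 l1 ty.
  have [m0 m1 Dm Gm gE] := cover_forms l0 l1 ncg dg ev0 ev1 evoo evm r0 r1 roo rm.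
  rewrite (iso_class_eq fg) gE !inE /=.
  apply/mapP; exists m => //; rewrite mem_filter Dm sE m0 m1 Gm.
  by [].
rewrite !inE /= => /mapP[m /s'E[m0 m1 Dm Gm] ->].
exists (fourth_cover l m) => //.
by have [[]] := fourth_cover_has_type l0 l1 m0 m1 Dm Gm.
Qed.

Let n := (p + dt - (e1 + e2))%N.

(** The number of covers drops exactly when l is the p-th power of a root of D,
    that is, when l is itself a root of D. *)
Lemma num_covers_generic l : l != 0 -> l != 1 ->
  (num_covers d es (branch4 (Some l)) <= n)%N /\
  (num_covers d es (branch4 (Some l)) < n)%N = root D l.
Proof.
move=> l0 l1; have [s [us ss sE]] := points_exist l0 l1.
rewrite (num_coversE l0 l1 us sE) /n -ss.
split; first exact: count_size.
rewrite -(count_predC (root D) s) -[X in (X < _)%N]add0n ltn_add2r -has_count.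
apply/hasP/idP => [[m] | Dl].
  rewrite sE => /and3P[m0 m1 Gm] Dm.
  have Nm : N.[m] != 0.
    by rewrite (coprimep_root (q := N) _ Dm) // coprimep_sym.
  move: Gm; rewrite /root /den_form hornerD !hornerZ (eqP Dm) mulr0 addr0.
  rewrite mulf_eq0 (negPf Nm) orbF subr_eq0 => /eqP <-.
  by rewrite -/(root _ _) frobenius_roots.
have /closed_rootP[m] : size ('X ^+ p - l%:P) != 1%N.
  by rewrite size_XnsubC ?p_gt0 // eqSS -lt0n p_gt0.
rewrite /root hornerD hornerN hornerC hornerXn subr_eq0 => /eqP mE.
have Dm : root D m by rewrite -frobenius_roots mE.
exists m => //; rewrite sE; apply/and3P; split.
- by apply: contraNneq l0 => m0; rewrite -mE m0 expr0n (gtn_eqF p_gt0).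
- by apply: contraNneq l1 => m1; rewrite -mE m1 expr1n.
- by rewrite /den_form mE subrr scale0r add0r /root hornerZ (eqP Dm) mulr0.
Qed.

Lemma P1_minus3P (y : P1 k) :
  P1_minus3 y <-> exists l, [/\ y = Some l, l != 0 & l != 1].
Proof.
rewrite /P1_minus3 /branch3 /=; split.
  case: y => [l|]; rewrite !inE ?eqxx ?orbT // => /norP[l0 /norP[l1 _]].
  by exists l.
by case=> l [-> l0 l1]; rewrite !inE !negb_or; apply/and3P.
Qed.

Lemma hurwitzE : hurwitz k d es = n.
Proof.
rewrite /hurwitz; set A := (X in supremum _ X).
(* The maximum is attained at any l that is not a root of D. *)
have An : A n.
  have : 'X * ('X - 1%:P) * D != 0.
    by rewrite !mulf_neq0 ?polyX_eq0 ?polyXsubC_eq0 ?D_neq0.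
  move=> /closed_nonrootP[l]; rewrite !rootM !negb_or rootX root_XsubC.
  move=> /andP[/andP[l0 l1] Dl]; exists (Some l).
    by apply/P1_minus3P; exists l.
  have [le lt] := num_covers_generic l0 l1.
  by apply/eqP; rewrite eqn_leq le /= leqNgt lt.
have ub : ubound A n.
  move=> _ [y /P1_minus3P[l [-> l0 l1]] <-].
  by have [le _] := num_covers_generic l0 l1.
rewrite /supremum ifF; last by apply/negP => /eqP A0; rewrite A0 in An.
have sA : supremums A n by split=> // z /(_ n An).
by rewrite (is_subset1_supremums (xgetPex _ (ex_intro _ n sA)) sA).
Qed.

Lemma supersingularE :
  supersingular k d es =
    [set y | P1_minus3 y /\ exists2 a, y = Some a & D.[a] = 0].
Proof.
apply/seteqP; split=> y /= [/[dup] yP /P1_minus3P[l [yE l0 l1]]].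
  have [_ lt] := num_covers_generic l0 l1.
  rewrite hurwitzE yE lt => /eqP Dl; split; first by rewrite -yE.
  by exists l.
case=> a; rewrite yE => -[<-] Dl; split; first by rewrite -yE.
by have [_ lt] := num_covers_generic l0 l1; rewrite hurwitzE lt; apply/eqP.
Qed.

End FourthPoint.

(** * The supersingular locus *)

Theorem corollary3p5 (p : nat) (k : closedFieldType) (e1 e2 e3 : nat)
    (p_prime : prime p) (p_odd : odd p) (p_char : p \in [pchar k])
    (e1_bounds : (1 < e1 < p)%N) (e2_bounds : (1 < e2 < p)%N)
    (e3_bounds : (1 < e3 < p)%N)
    (E_even : ~~ odd (e1 + e2 + e3)) (e3_neq : e3 <> (p - 1)%N)
    (E_ge : (p + 1 <= e1 + e2 + e3)%N)
    (E_le : (e1 + e2 + e3 <= p - 1 + 2 * minn e1 (minn e2 e3))%N) :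
  let d := ((e1 + e2 + e3 + p - 3) %/ 2)%N in
  let dt := (d + 1 - e3)%N in
  forall (h : ratfun k) (h1 h2 : {poly k}),
    has_type dt [:: e1; e2; (p - e3)%N] (branch3 k) h ->
    normalized h ->
    h = rpoly ('X^e1 * h1) / rpoly h2 ->
    coprimep ('X^e1 * h1) h2 ->
    size h1 = (dt - e1).+1 ->
    size h2 = (dt - (p - e3)).+1 ->
  supersingular k d [:: e1; e2; e3; (p - 1)%N] =
    [set y : P1 k | P1_minus3 y /\
       exists2 a : k, y = Some a & h2.[a] = 0].
Proof.
move=> d dt h h1 h2 hty hnorm hE cop sh1 sh2; rewrite subn1.
have [q EE] : exists q, (e1 + e2 + e3 = 2 * q)%N.
  by exists (e1 + e2 + e3)./2; rewrite mul2n even_halfK.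
have [r pE] : exists r, p = (2 * r + 1)%N.
  by exists p./2; rewrite mul2n addnC -[LHS](odd_double_half p) p_odd.
have dE : d = (q + r - 1)%N.
  by rewrite /d EE pE; clear; lia.
have arith : [/\ (e3 <= d + 1)%N, (e1 <= dt)%N, (p - e3 <= dt)%N,
   (e1 + e2 = dt + (dt - (p - e3)) + 1)%N & (d + 1 = dt + e3)%N].
  have m1 : (minn e1 (minn e2 e3) <= e1)%N by rewrite geq_min leqnn.
  have m2 : (minn e1 (minn e2 e3) <= e2)%N by rewrite !geq_min leqnn orbT.
  have m3 : (minn e1 (minn e2 e3) <= e3)%N by rewrite !geq_min leqnn !orbT.
  move: E_ge E_le e1_bounds e2_bounds e3_bounds EE m1 m2 m3.
  rewrite /dt dE pE; move: (minn _ _) => mn.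
  clear=> *; split; lia.
have [_ e1dt pdt eE ddt] := arith.
have h20 : h2 != 0 by rewrite -size_poly_gt0 sh2.
have h10 : h1 != 0 by rewrite -size_poly_gt0 sh1.
have sN : size ('X^e1 * h1) = dt.+1.
  by rewrite size_monicM ?monicXn // size_polyXn sh1 /= addnS subnKC.
have dvdN1 : ('X - 1%:P) ^+ e2 %| 'X^e1 * h1 - h2.
  case: hty => [[dgt0 _ _] _ _ _ fib]; have nch := nonconst_degree dgt0.
  have [x [/= hx rx uniqx]] := fib 1%N isT.
  have [ev1 ram1] : evalr h (pt1 k) = pt1 k /\ ramified h (pt1 k).
    by apply: hnorm; rewrite !inE eqxx orbT.
  have := rx; rewrite -(uniqx _ ev1 ram1) (ram_index_finite nch ev1) scale1r.
  have [c c0 [nE dnE]] := lowest_terms h20 cop hE.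
  rewrite nE dnE -scalerBr => mupE; rewrite -(dvdpZr _ _ c0) -mup_geq ?mupE //.
  rewrite scalerBr -nE -dnE -[denom h]scale1r; exact: nonconst_num_neq0.
apply: (supersingularE p_char e1_bounds e2_bounds e3_bounds
  (esym (subnK pdt)) eE ddt sN sh2 cop _ dvdN1).
by rewrite dvdp_mulr.
Qed.
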